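(* Consider synchronous federated Q-learning with $K$ agents, synchronization period $E$, time-invariant stepsize $\lambda>0$, $T$ iterations, discount factor $\gamma\in(0,1)$, rewards in $[0,1]$, and $0\le Q_0(s,a)\le\frac1{1-\gamma}$ for all $(s,a)$. Let $\epsilon>0$ be a target accuracy and suppose $E-1\le\frac1\lambda\min\{\frac{1-\gamma}{4\gamma},\frac1K\}$ and $\lambda\le\frac1E$. For $\delta\in(0,\frac13)$ define $$x_1=\frac{4096\log\frac{|\mathcal S||\mathcal A|K}{\delta}\log^2\big(\frac{(1-\gamma)^2\epsilon}{8}\big)}{K(1-\gamma)^5\epsilon^2},\qquad x_2=\frac{168\,\kappa(E-1)\gamma^2}{(1-\gamma)^3\epsilon}\log^2\Big(\frac{(1-\gamma)^2\epsilon}{12}\Big),$$ $$x_3=\frac{9216}{K(1-\gamma)^5\epsilon^2}\log\frac{|\mathcal S||\mathcal A|K}{\delta}\log^2\Big(\frac{(1-\gamma)^2\epsilon}{12}\Big).$$ (i) When $\kappa=0$ or $E=1$: for any $\delta\in(0,\frac13)$, with probability at least $1-3\delta$, $\|\Delta_T\|_\infty\le\epsilon$ when $T\ge\exp\{-W_{-1}(-\frac1{x_1})\}$ and $\lambda=\frac{\epsilon^2(1-\gamma)^4K}{2304\log\frac{|\mathcal S||\mathcal A|KT}{\delta}}$. The resulting sample complexity is $\tilde{\mathcal O}\big(\frac{|\mathcal S||\mathcal A|}{K(1-\gamma)^5\epsilon^2}\big)$. (ii) When $\kappa>0$ and $E>1$: (a) if $K(E-1)\ge\frac{55\log\frac{|\mathcal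 S||\mathcal A|K}{\delta}}{\kappa\gamma^2\epsilon(1-\gamma)^2}$, then for any $\delta\in(0,\frac13)$, with probability at least $1-3\delta$, $\|\Delta_T\|_\infty\le\epsilon$ when $T\ge\exp\{-W_{-1}(-\frac1{x_2})\}$ and $\lambda=\frac{\epsilon(1-\gamma)^2}{42\kappa(E-1)\gamma^2}$. The sample complexity is $\tilde{\mathcal O}\big(\frac{\kappa|\mathcal S||\mathcal A|E}{(1-\gamma)^3\epsilon}\big)$. (b) if $K(E-1)\le\frac{55\log\frac{|\mathcal S||\mathcal A|K}{\delta}}{\kappa\gamma^2\epsilon(1-\gamma)^2}$, then for any $\delta\in(0,\frac13)$, with probability at least $1-3\delta$, $\|\Delta_T\|_\infty\le\epsilon$ when $T\ge\exp\{-W_{-1}(-\frac1{x_3})\}$ and $\lambda=\frac{\epsilon^2(1-\gamma)^4K}{2304\log\frac{|\mathcal S||\mathcal A|KT}{\delta}}$. The sample complexity is $\tilde{\mathcal O}\big(\frac{|\mathcal S||\mathcal A|}{K(1-\gamma)^5\epsilon^2}\big)$.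
   Context: Setting. $\mathcal S,\mathcal A$ are finite state and action sets, $\gamma\in(0,1)$, $R:\mathcal S\times\mathcal A\to[0,1]$. There are $K\ge1$ agents; agent $k$ has the MDP $\langle\mathcal S,\mathcal A,\mathcal P^k,\gamma,R\rangle$ with transition kernel $P^k(\cdot\mid s,a)$. The global kernel is $\bar P(s'\mid s,a)=\frac1K\sum_{k=1}^K P^k(s'\mid s,a)$. The transition heterogeneity is $\kappa=\sup_{k,s,a}\|\bar P(\cdot\mid s,a)-P^k(\cdot\mid s,a)\|$, where the row vector is measured in the induced (operator) $\infty$-norm of a $1\times|\mathcal S|$ matrix, i.e. $\sum_{s'}|\bar P(s'\mid s,a)-P^k(s'\mid s,a)|$. $Q^*$ is the optimal Q-function of the global MDP $\langle\mathcal S,\mathcal A,\bar{\mathcal P},\gamma,R\rangle$, i.e. the unique solution of $Q^*(s,a)=R(s,a)+\gamma\sum_{s'}\bar P(s'\mid s,a)\max_{a'}Q^*(s',a')$. Algorithm (synchronous federated Q-learning, integers $E,T\ge1$, stepsize $\lambda$, initial $Q_0\in\mathbb R^{|\mathcal S||\mathcal A|}$). Set $Q_0^k=Q_0$ for all $k$. At each iteration $t=0,1,\dots,T-1$, every agent $k$ draws, for every $(s,a)$, a sample $s_t^k(s,a)\sim P^k(\cdot\mid s,a)$, all samples being independent across $(s,a)$, $t$ and $k$, and computes $Q^k_{t+1/2}(s,a)=(1-\lambda)Q^k_t(s,a)+\lambda\big(R(s,a)+\gamma\max_{a'}Q^k_t(s_t^k(s,a),a')\big)$. If $(t+1)\bmod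 E=0$, then $Q^k_{t+1}=\frac1K\sum_{j=1}^K Q^j_{t+1/2}$ for all $k$; otherwise $Q^k_{t+1}=Q^k_{t+1/2}$. Notation: $\bar Q_t=\frac1K\sum_{k=1}^K Q_t^k$, $\Delta_t=Q^*-\bar Q_t$, $\|\cdot\|_\infty$ is the maximum absolute entry of a vector. $W_{-1}$ is the lower real branch of the Lambert $W$ function, defined on $[-1/e,0)$ (so the thresholds presuppose $x_i\ge e$). Sample complexity means the number of samples per agent, $|\mathcal S||\mathcal A|T$, with $T$ equal to the stated threshold; $\tilde{\mathcal O}$ hides numerical constants and polylogarithmic factors. *)

(* Defs.v *)
From HB Require Import structures.
From mathcomp Require Import all_boot all_order all_algebra.
From mathcomp Require Import all_classical all_reals all_analysis.
From mathcomp Require Import ring lra.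

Set Implicit Arguments.
Unset Strict Implicit.
Unset Printing Implicit Defensive.
Import Order.TTheory GRing.Theory Num.Theory.
Import numFieldNormedType.Exports.

Local Open Scope classical_set_scope.
Local Open Scope ring_scope.

Section LambertW.
Variable R : realType.

(* Lower real branch: for -1/e <= x < 0 exactly one w <= -1 satisfies
   w * e^w = x (see lambertWm1P); the value 0 outside that range is junk. *)
Definition lambertWm1 (x : R) : R :=
  xget 0 [set w | w <= -1 /\ w * expR w = x].

Lemma lambertWm1P (x : R) : - expR (-1) <= x < 0 ->
  [/\ lambertWm1 x <= -1, lambertWm1 x * expR (lambertWm1 x) = x
    & forall w, w <= -1 -> w * expR w = x -> w = lambertWm1 x].
Proof.
move=> /andP[xlo xhi].
have uniq (v w : R) : v <= -1 -> v < w -> w <= -1 -> v * expR v = w * expR w -> False.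
  move=> v1 vw w1 e.
  have d0 : 0 < w - v by rewrite subr_gt0.
  have ed : 1 + (w - v) < expR (w - v) by apply: expR_gt1Dx; rewrite gt_eqF.
  have ev : v = w * expR (w - v).
    by rewrite expRD expRN mulrA -e mulfK // gt_eqF // expR_gt0.
  have w0 : w < 0 by lra.
  have : w * expR (w - v) < w * (1 + (w - v)) by rewrite ltr_nM2l.
  rewrite -ev; nra.
have [w [w1 we]] : exists w : R, w <= -1 /\ w * expR w = x.
  have e1 : expR (-1) <= 1 :> R by rewrite expR_le1; lra.
  pose s := 2 / - x.
  have sx : s * - x = 2 by rewrite /s divfK // oppr_eq0 lt_eqF.
  have s0 : 0 < s by rewrite /s divr_gt0 // oppr_gt0.
  have xg : - x <= 1 by lra.
  have s2 : 2 <= s by nra.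
  have es : 1 + s <= expR s by exact: expR_ge1Dx.
  have fa : x <= (- (2 * s)) * expR (- (2 * s)).
    have -> : - (2 * s) = - s + - s by ring.
    rewrite expRD !expRN.
    have i0 : 0 < (expR s)^-1 by rewrite invr_gt0 expR_gt0.
    have ii : expR s * (expR s)^-1 = 1 by rewrite divff // gt_eqF // expR_gt0.
    have si : s * (expR s)^-1 <= 1 by nra.
    rewrite -(ler_pM2l s0).
    have : s * (expR s)^-1 * (s * (expR s)^-1) <= 1.
      by apply: mulr_ile1 => //; rewrite mulr_ge0 // ltW.
    nra.
  have ab : - (2 * s) <= -1 by lra.
  have cf : {within `[- (2 * s), -1], continuous (fun w : R => w * expR w)}.
    apply: continuous_subspaceT => w.
    by apply: cvgM; [exact: cvg_id | exact: continuous_expR].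
  have [|c cab cx] := IVT ab cf (v := x).
    apply/andP; split.
      by rewrite ge_min; apply/orP; right; rewrite mulN1r.
    by rewrite le_max fa.
  by exists c; split => //; move: cab; rewrite in_itv /= => /andP[].
have [L1 L2] : [set w | w <= -1 /\ w * expR w = x] (lambertWm1 x).
  by rewrite /lambertWm1; case: xgetP => [//|/(_ w)[]].
split=> // v v1 ve.
have [lt|lt|//] := ltgtP v (lambertWm1 x).
- by case: (uniq _ _ v1 lt L1); rewrite ve.
- by case: (uniq _ _ L1 lt v1); rewrite ve.
Qed.

(* The larger root T of T = x * ln T, for x >= e. *)
Definition threshold (x : R) : R := expR (- lambertWm1 (- x^-1)).

End LambertW.

Section MDP.
Context {R : realType} {S A : finType}.
Implicit Types (P : S -> A -> S -> R) (Q : S -> A -> R).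

Definition transition_kernel P : Prop :=
  (forall s a s', 0 <= P s a s') /\ (forall s a, \sum_(s' : S) P s a s' = 1).

(* The base point a0 only witnesses that A is nonempty: it is one of the
   maximands, so the value does not depend on it. *)
Definition maxQ (a0 : A) Q (s : S) : R := \big[Num.max/Q s a0]_(a : A) Q s a.

Definition normQ Q : R := \big[Num.max/0]_(z : S * A) `|Q z.1 z.2|.

Definition optimal_Q (a0 : A) P (gamma : R) (r : S -> A -> R) Q : Prop :=
  forall s a, Q s a = r s a + gamma * \sum_(s' : S) P s a s' * maxQ a0 Q s'.

Definition global_kernel (K : nat) (Pk : 'I_K -> S -> A -> S -> R) :
    S -> A -> S -> R :=
  fun s a s' => K%:R^-1 * \sum_(k < K) Pk k s a s'.

(* The induced infinity-norm of a row is the sum of its absolute entries. *)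
Definition heterogeneity (K : nat) (Pk : 'I_K -> S -> A -> S -> R) : R :=
  \big[Num.max/0]_(z : 'I_K * S * A)
    \sum_(s' : S)
      `|global_kernel Pk z.1.2 z.2 s' - Pk z.1.1 z.1.2 z.2 s'|.

(* y t k s a is the next state drawn by agent k for (s, a) at iteration t. *)
Definition half_step (a0 : A) (gamma lambda : R) (r : S -> A -> R)
    (q : S -> A -> R) (y : S -> A -> S) : S -> A -> R :=
  fun s a => (1 - lambda) * q s a
             + lambda * (r s a + gamma * maxQ a0 q (y s a)).

Fixpoint fedQ (a0 : A) (K E : nat) (gamma lambda : R) (r Q0 : S -> A -> R)
    (y : nat -> 'I_K -> S -> A -> S) (t : nat) {struct t} :
    'I_K -> S -> A -> R :=
  match t with
  | 0 => fun _ => Q0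
  | u.+1 =>
    let Qhalf k :=
      half_step a0 gamma lambda r (fedQ a0 E gamma lambda r Q0 y u k) (y u k) in
    if (u.+1 %% E == 0)%N
    then fun _ s a => K%:R^-1 * \sum_(j < K) Qhalf j s a
    else Qhalf
  end.

Definition avgQ (a0 : A) (K E : nat) (gamma lambda : R) (r Q0 : S -> A -> R)
    (y : nat -> 'I_K -> S -> A -> S) (t : nat) : S -> A -> R :=
  fun s a => K%:R^-1 * \sum_(k < K) fedQ a0 E gamma lambda r Q0 y t k s a.

End MDP.

Section Sampling.
Context {R : realType} {d : measure_display} {Omega : measurableType d}.
Variable Pr : probability Omega R.

Definition mutually_independent (I S : finType) (X : I -> Omega -> S) : Prop :=
  forall (J : {set I}) (B : I -> set S),
    Pr (\bigcap_(i in [set` J]) (X i @^-1` B i)) =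
    (\prod_(i in J) Pr (X i @^-1` B i))%E.

(* Measurability of a map into the finite set S is stated on singletons. *)
Definition generative_samples (S A : finType) (K T : nat)
    (Pk : 'I_K -> S -> A -> S -> R)
    (X : nat -> 'I_K -> S -> A -> Omega -> S) : Prop :=
  [/\ forall t k s a s', (t < T)%N ->
        measurable (X t k s a @^-1` [set s']),
      forall t k s a s', (t < T)%N ->
        Pr (X t k s a @^-1` [set s']) = (Pk k s a s')%:E
    & mutually_independent
        (fun z : 'I_T * 'I_K * S * A => X z.1.1.1 z.1.1.2 z.1.2 z.2)].

End Sampling.

Section Complexity.
Context {R : realType}.

Definition x1 (nS nA K : nat) (gamma eps delta : R) : R :=
  4096%:R * ln ((nS * nA * K)%:R / delta)
    * ln ((1 - gamma) ^+ 2 * eps / 8%:R) ^+ 2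
  / (K%:R * (1 - gamma) ^+ 5 * eps ^+ 2).

Definition x2 (E : nat) (kappa gamma eps : R) : R :=
  168%:R * kappa * (E%:R - 1) * gamma ^+ 2 / ((1 - gamma) ^+ 3 * eps)
  * ln ((1 - gamma) ^+ 2 * eps / 12%:R) ^+ 2.

Definition x3 (nS nA K : nat) (gamma eps delta : R) : R :=
  9216%:R / (K%:R * (1 - gamma) ^+ 5 * eps ^+ 2)
  * ln ((nS * nA * K)%:R / delta)
  * ln ((1 - gamma) ^+ 2 * eps / 12%:R) ^+ 2.

(* The number of iterations is the threshold rounded up to an integer. *)
Definition sample_complexity (nS nA : nat) (x : R) : R :=
  (nS * nA)%:R * (Num.ceil (threshold x))%:~R.

(* "f is soft-O of g" reads: there are constants C and p, independent of the
   problem instance, with f <= C * g * polylog p z on every instance, where z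
   lists the parameters whose logarithms are hidden. *)
Definition polylog (p : nat) (z : seq R) : R :=
  (1 + \sum_(c <- z) `|ln c|) ^+ p.

End Complexity.

(* Main.v *)
(* Write a sampling error as (P^k - sample) V*.  Since V* is deterministic,
   these errors are independent over iterations, agents and state-action pairs.
   Removing from Q* - (average iterate) the exponentially weighted sum of the
   agent-averaged errors, and from Q* - (iterate of agent k) the sum of the
   errors of agent k since the last synchronization, leaves a deterministic
   recursion in sup norm with contraction factor 1 - (1 - gamma) lambda / 2, in
   which heterogeneity enters only through lambda (E - 1) kappa.

   The recursion is linear with nonnegative coefficients in the noise norms, so
   the final error is the bias plus a combination of noise norms.  Exponential
   moments of such a combination are controlled by convexity instead of a union
   bound over time: this gives log(|S||A|K/delta) without T, which is what case
   (a) needs, since there lambda does not shrink as T grows. *)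
Require Import Defs.
From HB Require Import structures.
From mathcomp Require Import all_boot all_order all_algebra.
From mathcomp Require Import all_classical all_reals all_analysis.
From mathcomp Require Import ring lra.
Import Order.TTheory GRing.Theory Num.Theory.
Local Open Scope classical_set_scope.
Local Open Scope ring_scope.

Set Implicit Arguments.
Unset Strict Implicit.
Unset Printing Implicit Defensive.

(** * Scalar inequalities and the Lambert threshold *)

Section Scalars.
Variable R : realType.
Implicit Types x y t : R.

(** The isolated linear term will vanish in expectation for centred noise, leaving a sub-Gaussian
    factor. Up to [2 / 3] one inverts [(1 - x / 2) ^+ 2 <= expR (- x)]; beyond,
    [x <= 3 / 2 * x ^+ 2]. *)
Lemma expR_le_quad x : expR x <= x + expR (3 / 2 * x ^+ 2).
Proof.
have q1 : 1 + 3 / 2 * x ^+ 2 <= expR (3 / 2 * x ^+ 2) by exact: expR_ge1Dx.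
have [x23|x23] := leP x (2 / 3).
  have h : 1 + - x / 2 <= expR (- x / 2) by exact: expR_ge1Dx.
  have hx : 0 <= 1 + - x / 2 by lra.
  have e2 : (1 - x / 2) ^+ 2 <= expR (- x).
    have -> : - x = - x / 2 + - x / 2 by field.
    by rewrite expRD -expr2 ler_sqr ?nnegrE ?expR_ge0 //; lra.
  have ee : expR x * expR (- x) = 1 by rewrite expRxMexpNx_1.
  have p0 := expR_gt0 x.
  have qq : 1 <= (1 + x + 3 / 2 * x ^+ 2) * (1 - x / 2) ^+ 2.
    (* The smaller root of the quadratic factor is about 0.78, above [2 / 3]. *)
    have : 0 <= x ^+ 2 * (3 / 4 - 5 / 4 * x + 3 / 8 * x ^+ 2).
      by apply: mulr_ge0; rewrite ?sqr_ge0 //; nra.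
    by move=> h0; rewrite -subr_ge0 [leRHS](_ : _ = x ^+ 2 * (3 / 4 - 5 / 4 * x + 3 / 8 * x ^+ 2)) //; field.
  have q0 : 0 < 1 + x + 3 / 2 * x ^+ 2 by nra.
  suff : expR x <= 1 + x + 3 / 2 * x ^+ 2 by lra.
  move: qq q0; set q := (1 + x + _) => qq q0.
  have : 1 <= q * expR (- x) by apply: le_trans qq _; rewrite ler_pM2l.
  by rewrite -(ler_pM2r p0) mul1r -mulrA [expR (- x) * _]mulrC ee mulr1.
have : expR x <= expR (3 / 2 * x ^+ 2) by rewrite ler_expR; nra.
lra.
Qed.

(** The tangent of [expR] at [m] lies below the curve at both points; in the weighted sum of the two
    inequalities the slopes cancel. *)
Lemma expR_convex2 x y t : 0 <= t <= 1 ->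
  expR (t * x + (1 - t) * y) <= t * expR x + (1 - t) * expR y.
Proof.
move=> /andP[t0 t1]; set m := t * x + _.
have e z : expR m * (1 + (z - m)) <= expR z.
  rewrite -[in leRHS](subrK m z) [leRHS]expRD [leLHS]mulrC ler_pM2r ?expR_gt0 //.
  exact: expR_ge1Dx.
have := ler_wpM2l t0 (e x).
have : (1 - t) * (expR m * (1 + (y - m))) <= (1 - t) * expR y.
  by apply: ler_wpM2l (e y); rewrite subr_ge0.
have -> : (1 - t) * (expR m * (1 + (y - m))) =
   expR m - t * (expR m * (1 + (x - m))) by rewrite /m; ring.
lra.
Qed.

(** Multiplying [w * expR w = - x^-1] by [expR (- w)] gives the equation, [- w] being the logarithm
    of the threshold; [w <= -1] on this branch gives the second claim. *)
Lemma threshold_spec x : expR 1 <= x ->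
  threshold x = x * ln (threshold x) /\ 1 <= ln (threshold x).
Proof.
move=> ex; have x0 : 0 < x by apply: lt_le_trans ex; exact: expR_gt0.
have [|w1 wE _] := @lambertWm1P R (- x^-1).
  rewrite oppr_lt0 invr_gt0 x0 andbT lerN2 expRN lef_pV2 //.
  by rewrite posrE expR_gt0.
rewrite /threshold expRK; split; last lra.
move: wE; set w := lambertWm1 _ => wE.
have e : expR w * expR (- w) = 1 by rewrite expRxMexpNx_1.
have : w * (expR w * expR (- w)) = - x^-1 * expR (- w) by rewrite -wE mulrA.
rewrite e mulr1 => wx; have {}wx : - w = x^-1 * expR (- w).
  by rewrite {1}wx mulNr opprK.
by rewrite [in RHS]wx mulrA divff ?mul1r // gt_eqF.
Qed.

Lemma threshold_gt0 x : 0 < threshold x.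
Proof. exact: expR_gt0. Qed.

(** With [b] the logarithm of the threshold, [b = ln x + ln b], and [ln b <= b / 2] yields
    [b <= 2 * ln x]. *)
Lemma threshold_le_xlnx x : expR 1 <= x -> threshold x <= 2 * (x * ln x).
Proof.
move=> ex; have x0 : 0 < x by apply: lt_le_trans ex; exact: expR_gt0.
have [TE b1] := threshold_spec ex; rewrite TE.
set b := ln (threshold x) in TE b1 *.
have bE : b = ln x + ln b.
  by rewrite {1}/b TE lnM // posrE; exact: lt_le_trans b1.
have bb : b <= expR (b / 2).
  have -> : b / 2 = b / 4 + b / 4 by field.
  have h : 1 + b / 4 <= expR (b / 4) by exact: expR_ge1Dx.
  rewrite expRD; have u0 : 0 <= 1 + b / 4 by lra.
  by have := ler_pM u0 u0 h h; have := sqr_ge0 (1 - b / 4); lra.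
have : ln b <= b / 2.
  by rewrite -[leRHS]expRK ler_ln // posrE ?expR_gt0 //; lra.
nra.
Qed.

(** The concave map [x * ln t] stays below its tangent at the threshold, where it meets the identity
    with slope [x / T <= 1]. *)
Lemma threshold_le_mono x t : expR 1 <= x -> threshold x <= t ->
  x * ln t <= t /\ 1 <= ln t.
Proof.
move=> ex; have x0 : 0 < x by apply: lt_le_trans ex; exact: expR_gt0.
have [TE b1] := threshold_spec ex; have T0 := threshold_gt0 x.
move: TE b1 T0; set T := threshold x => TE b1 T0 Tt.
have t0 : 0 < t by exact: lt_le_trans Tt.
have l1 : ln T <= ln t by rewrite ler_ln // posrE.
split; last by apply: le_trans l1.
have h : ln (t / T) <= t / T - 1.
  have := @le_ln1Dx R (t / T - 1); rewrite [1 + _]addrC subrK; apply.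
  by rewrite ltrBrDr addNr divr_gt0.
rewrite ln_div ?posrE // in h.
have Tx : x <= T by rewrite TE; nra.
have xT : x / T <= 1 by rewrite ler_pdivrMr // mul1r.
have -> : t = T + (t - T) by ring.
have -> : T + (t - T) = t by ring.
have : x * ln t <= x * (ln T + (t / T - 1)) by rewrite ler_pM2l //; lra.
have -> : x * (ln T + (t / T - 1)) = T + x / T * (t - T).
  by rewrite mulrDr -TE; field; rewrite gt_eqF.
nra.
Qed.

(** The power 4 of the logarithmic factor [Y] is 3 from [x] plus 1 from [ln x]; the constant 4 is 2
    from rounding up times 2 from [threshold_le_xlnx]. *)
Lemma sample_complexity_le (nS nA : nat) x c g W Y :
  expR 1 <= x -> 1 <= Y -> 0 <= c -> 0 <= g ->
  x <= c * g * Y ^+ 3 -> ln x <= W * Y ->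
  sample_complexity nS nA x <= 4 * c * W * ((nS * nA)%:R * g) * Y ^+ 4.
Proof.
move=> ex Y1 c0 g0 xle lxle.
have x0 : 0 < x by apply: lt_le_trans ex; exact: expR_gt0.
have x1 : 1 <= x.
  by apply: le_trans ex; rewrite -[leLHS]expR0 ler_expR; exact: ler01.
have lx1 : 0 <= ln x by exact: ln_ge0.
have [TE b1] := threshold_spec ex.
have T1 : 1 <= threshold x by rewrite TE; nra.
have cT : (Num.ceil (threshold x))%:~R <= 2 * threshold x.
  have := ceilB1_lt (threshold x); rewrite intrB; lra.
have : (Num.ceil (threshold x))%:~R <= 4 * (x * ln x).
  have := threshold_le_xlnx ex; lra.
have : x * ln x <= (c * g * Y ^+ 3) * (W * Y) by apply: ler_pM => //; exact: ltW.
move=> h1 h2.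
have -> : 4 * c * W * ((nS * nA)%:R * g) * Y ^+ 4 =
  (nS * nA)%:R * (4 * ((c * g * Y ^+ 3) * (W * Y))) by ring.
by apply: ler_wpM2l => //; lra.
Qed.

(** Completing the square bounds the exponent by [ln y + 9 / 16], and [expR (9 / 16) <= 16 / 7]
    since [expR (- (9 / 16)) >= 7 / 16]. *)
Lemma bias_exponent (y e : R) : 0 < y -> 4 / 9 * ln y ^+ 2 <= e ->
  expR (- e) <= 16 / 7 * y.
Proof.
move=> y0 he.
have a : - e <= ln y + 9 / 16 by have := sqr_ge0 (2 / 3 * ln y + 3 / 4); lra.
apply: (@le_trans _ _ (expR (ln y + 9 / 16))); first by rewrite ler_expR.
rewrite expRD lnK // mulrC ler_pM2r //.
have : 1 + - (9 / 16) <= expR (- (9 / 16 : R)) by exact: expR_ge1Dx.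
rewrite expRN => h.
have p : 0 < expR (9 / 16 : R) := expR_gt0 _.
rewrite -[leLHS]invrK -[16 / 7]invrK lef_pV2 ?posrE ?invr_gt0 //; lra.
Qed.

End Scalars.

(** * Pathwise recursion *)

Section Norms.
Variables (R : realType) (S A : finType) (a0 : A).
Implicit Types (P : S -> A -> S -> R) (Q : S -> A -> R).

Lemma normQ_ub Q s a : `|Q s a| <= normQ Q.
Proof. exact: (le_bigmax _ (fun z : S * A => `|Q z.1 z.2|) (s, a)). Qed.

Lemma normQ_ge0 Q : 0 <= normQ Q.
Proof. exact: bigmax_ge_id. Qed.

Lemma normQ_le Q c : 0 <= c -> (forall s a, `|Q s a| <= c) -> normQ Q <= c.
Proof. by move=> c0 h; apply: bigmax_le => // -[s a] _; exact: h. Qed.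

Lemma maxQ_lipschitz Q Q' s c : (forall a, `|Q s a - Q' s a| <= c) ->
  `|maxQ a0 Q s - maxQ a0 Q' s| <= c.
Proof.
have aux Q1 Q2 : (forall a, `|Q1 s a - Q2 s a| <= c) ->
    maxQ a0 Q1 s <= c + maxQ a0 Q2 s.
  move=> h; have h1 a : Q1 s a <= c + maxQ a0 Q2 s.
    have := le_bigmax (Q2 s a0) (Q2 s) a; rewrite -/(maxQ a0 Q2 s).
    have := ler_norm (Q1 s a - Q2 s a); have := h a; lra.
  by apply: bigmax_le => // a _; exact: h1.
move=> h; have h1 := aux _ _ h.
have h2 : maxQ a0 Q' s <= c + maxQ a0 Q s by apply: aux => a; rewrite distrC.
by rewrite ler_norml; apply/andP; split; lra.
Qed.

Lemma maxQ_bound Q s c : (forall a, `|Q s a| <= c) -> `|maxQ a0 Q s| <= c.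
Proof.
move=> h; have := @maxQ_lipschitz Q (fun _ _ => 0) s c.
have -> : maxQ a0 (fun _ _ => 0) s = 0 :> R by apply: bigmax_eq_id.
by rewrite subr0; apply => a; rewrite subr0.
Qed.

Lemma kernel_sum_le (p : S -> R) (f : S -> R) c :
  (forall s, 0 <= p s) -> \sum_s p s = 1 -> (forall s, `|f s| <= c) ->
  `|\sum_s p s * f s| <= c.
Proof.
move=> p0 p1 fc; apply: le_trans (ler_norm_sum _ _ _) _.
rewrite -[leRHS]mul1r -p1 mulr_suml; apply: ler_sum => s _.
by rewrite normrM ger0_norm // ler_wpM2l.
Qed.

Lemma mean_le (K : nat) (f : 'I_K -> R) c : (0 < K)%N ->
  (forall k, `|f k| <= c) -> `|K%:R^-1 * \sum_k f k| <= c.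
Proof.
move=> K0 fc; rewrite normrM ger0_norm ?invr_ge0 //.
rewrite mulrC ler_pdivrMr ?ltr0n //; apply: le_trans (ler_norm_sum _ _ _) _.
apply: (@le_trans _ _ (\sum_(k < K) c)); first exact: ler_sum.
by rewrite sumr_const card_ord mulr_natr.
Qed.

Lemma mean_const (K : nat) (c : R) : (0 < K)%N ->
  K%:R^-1 * \sum_(k < K) c = c.
Proof.
move=> K0; rewrite sumr_const card_ord -[c *+ K]mulr_natl mulKf //.
by rewrite pnatr_eq0 -lt0n.
Qed.

Lemma global_kernel_kernel (K : nat) (Pk : 'I_K -> S -> A -> S -> R) :
  (0 < K)%N -> (forall k, transition_kernel (Pk k)) ->
  transition_kernel (global_kernel Pk).
Proof.
move=> K0 h; split=> s a => [s'|].
  by rewrite mulr_ge0 ?invr_ge0 ?sumr_ge0 // => k _; have [] := h k.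
rewrite -mulr_sumr exchange_big /= (eq_bigr (fun=> 1)) ?mean_const // => k _.
by have [_] := h k.
Qed.

(** Bellman's equation bounds the norm [N] by [1 + gamma * N]. *)
Lemma optimal_Q_bound P gamma (r Qs : S -> A -> R) :
  transition_kernel P -> 0 < gamma < 1 -> (forall s a, 0 <= r s a <= 1) ->
  optimal_Q a0 P gamma r Qs -> normQ Qs <= (1 - gamma)^-1.
Proof.
move=> [P0 P1] /andP[g0 g1] hr hQ; set N := normQ Qs.
have N0 : 0 <= N by exact: normQ_ge0.
suff : N <= 1 + gamma * N.
  by move=> h; rewrite -[leRHS]mul1r ler_pdivlMr ?subr_gt0 //; lra.
apply: normQ_le => [|s a]; first by nra.
have V s' : `|maxQ a0 Qs s'| <= N by apply: maxQ_bound => a'; exact: normQ_ub.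
have := kernel_sum_le (P0 s a) (P1 s a) V.
rewrite hQ => h; apply: le_trans (ler_normD _ _) _; apply: lerD.
  by have /andP[? ?] := hr s a; rewrite ger0_norm.
by rewrite normrM gtr0_norm // ler_pM2l.
Qed.

End Norms.

Section Pathwise.
Variables (R : realType) (S A : finType) (a0 : A) (K E : nat).
Variables (gamma lambda : R) (r Q0 Qs : S -> A -> R).
Variable Pk : 'I_K -> S -> A -> S -> R.
Variable y : nat -> 'I_K -> S -> A -> S.

Local Notation q := (fedQ a0 E gamma lambda r Q0 y).
Local Notation V := (maxQ a0).

Definition noise (k : 'I_K) (s : S) (a : A) (s' : S) : R :=
  \sum_z Pk k s a z * V Qs z - V Qs s'.

Lemma avgQ_succ t s a : (0 < K)%N ->
  avgQ a0 E gamma lambda r Q0 y t.+1 s a =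
  (1 - lambda) * avgQ a0 E gamma lambda r Q0 y t s a
  + lambda * (r s a + gamma * (K%:R^-1 * \sum_k V (q t k) (y t k s a))).
Proof.
move=> K0; rewrite /avgQ /=.
have -> : K%:R^-1 * \sum_(k < K)
    (if (t.+1 %% E == 0)%N
     then fun (_ : 'I_K) (s : S) (a : A) => K%:R^-1 * \sum_j
        half_step a0 gamma lambda r (q t j) (y t j) s a
     else fun k => half_step a0 gamma lambda r (q t k) (y t k)) k s a
   = K%:R^-1 * \sum_k half_step a0 gamma lambda r (q t k) (y t k) s a.
  by case: ifP => // _; rewrite mean_const.
rewrite /half_step big_split /= -!mulr_sumr big_split /= -mulr_sumr.
rewrite -[in RHS](mean_const (r s a) K0); ring.
Qed.

Variables (T : nat) (gN : nat -> S -> A -> R) (lN : nat -> 'I_K -> S -> A -> R).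
Variables (Y : nat -> R) (H : R).
Hypotheses (K0 : (0 < K)%N) (g01 : 0 < gamma < 1) (l01 : 0 < lambda <= 1).
Hypothesis Pker : forall k, transition_kernel (Pk k).
Hypothesis Qopt : optimal_Q a0 (global_kernel Pk) gamma r Qs.
Hypothesis gN0 : forall s a, gN 0 s a = 0.
Hypothesis gNS : forall t s a, (t < T)%N -> gN t.+1 s a =
  (1 - lambda) * gN t s a
  + lambda * (K%:R^-1 * \sum_k noise k s a (y t k s a)).
Hypothesis lN0 : forall k s a, lN 0 k s a = 0.
Hypothesis lNS : forall t k s a, (t < T)%N -> lN t.+1 k s a =
  if (t.+1 %% E == 0)%N then 0
  else (1 - lambda) * lN t k s a + lambda * noise k s a (y t k s a).
Hypothesis gNY : forall t s a, `|gN t s a| <= Y t.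
Hypothesis lNY : forall t k s a, `|lN t k s a| <= Y t.
Hypothesis Hle : forall k s a,
  `|\sum_z (global_kernel Pk s a z - Pk k s a z) * V Qs z| <= H.

(** [gN] and [lN] stand for the accumulated averaged and local noises, given here only by their
    recursions; [Y] dominates both. *)
Definition gap (t : nat) : R := normQ (fun s a =>
  Qs s a - avgQ a0 E gamma lambda r Q0 y t s a - gamma * gN t s a).

(** Majorant of the agents' gaps after removal of local noise. It restarts from [gap] at a
    synchronization, where local noise is reset and the averaged noise must be added back. *)
Fixpoint drift (t : nat) : R :=
  if t is u.+1 then
    if (u.+1 %% E == 0)%N then gap u.+1 + gamma * Y u.+1
    else drift u + lambda * gamma * (H + gamma * Y u)
  else gap 0 + gamma * Y 0.

Let Y0 t (s : S) : 0 <= Y t.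
Proof. by apply: le_trans (gNY t s a0). Qed.

Let valueB t k s c : 
  (forall s a, `|Qs s a - q t k s a - gamma * lN t k s a| <= c) ->
  `|V Qs s - V (q t k) s| <= c + gamma * Y t.
Proof.
move=> h; apply: maxQ_lipschitz => a.
rewrite -[Qs s a - _](subrK (gamma * lN t k s a)).
apply: le_trans (ler_normD _ _) _; apply: lerD => //.
by have /andP[g0 _] := g01; rewrite normrM gtr0_norm // ler_pM2l.
Qed.

(** In a local step the old gap has weight [1 - lambda] and the value gap weight [lambda * gamma];
    since [gamma < 1] the drift is not amplified, and only heterogeneity and noise are added. At a
    synchronization every agent holds the average. *)
Lemma agent_gap_le_drift t k s a : (t <= T)%N ->
  `|Qs s a - q t k s a - gamma * lN t k s a| <= drift t.
Proof.
have /andP[g0 g1] := g01; have /andP[l0 l1] := l01.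
elim: t k s a => [|t IH] k s a tT.
  rewrite /= lN0 mulr0 subr0; apply: (@le_trans _ _ (gap 0)); last first.
    by rewrite lerDl mulr_ge0 ?(ltW g0) ?(@Y0 _ s).
  have := normQ_ub (fun s a =>
    Qs s a - avgQ a0 E gamma lambda r Q0 y 0 s a - gamma * gN 0 s a) s a.
  by rewrite /= gN0 mulr0 subr0 /avgQ /= mean_const.
have {}IH k' s' a' := IH k' s' a' (ltnW tT).
rewrite [drift _]/= lNS //; case: ifP => tE.
  rewrite mulr0 subr0.
  have -> : q t.+1 k s a = avgQ a0 E gamma lambda r Q0 y t.+1 s a.
    by rewrite /avgQ /= tE mean_const.
  rewrite -[_ - avgQ _ _ _ _ _ _ _ _ _ _](subrK (gamma * gN t.+1 s a)).
  apply: le_trans (ler_normD _ _) _; apply: lerD.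
    exact: (normQ_ub (fun s a =>
      Qs s a - avgQ a0 E gamma lambda r Q0 y t.+1 s a - gamma * gN t.+1 s a)).
  by rewrite normrM gtr0_norm // ler_pM2l.
rewrite /= tE /half_step.
(* Bellman's equation for the global kernel, recentred at the kernel of agent [k]; the mismatch
   becomes [h]. *)
have e : Qs s a = r s a + gamma *
    (\sum_z (global_kernel Pk s a z - Pk k s a z) * V Qs z
     + \sum_z Pk k s a z * V Qs z).
  rewrite Qopt -big_split /=; congr (_ + _ * _); apply: eq_bigr => z _; ring.
set h := \sum_z (_ - _) * _ in e.
have -> : Qs s a - ((1 - lambda) * q t k s a + lambda *
     (r s a + gamma * V (q t k) (y t k s a)))
   - gamma * ((1 - lambda) * lN t k s a + lambda * noise k s a (y t k s a))
  = (1 - lambda) * (Qs s a - q t k s a - gamma * lN t k s a)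
    + lambda * gamma * (h + (V Qs (y t k s a) - V (q t k) (y t k s a))).
  rewrite /noise [in LHS](_ : Qs s a = (1 - lambda) * Qs s a + lambda * Qs s a); last by ring.
  rewrite [X in lambda * X]e; ring.
have hb : `|h| <= H by exact: Hle.
have vb := valueB (y t k s a) (IH k).
have qb := IH k s a.
apply: le_trans (ler_normD _ _) _; rewrite !normrM.
rewrite [`|1 - lambda|]ger0_norm ?subr_ge0 // [`|lambda|]gtr0_norm //.
rewrite [`|gamma|]gtr0_norm //.
have := ler_normD h (V Qs (y t k s a) - V (q t k) (y t k s a)).
set n1 := `|h + _|; move=> n1b.
have lg0 : 0 < lambda * gamma by exact: mulr_gt0.
have : lambda * gamma * n1 <= lambda * gamma * (H + (drift t + gamma * Y t)).
  by rewrite ler_pM2l //; lra.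
have : (1 - lambda) * `|Qs s a - q t k s a - gamma * lN t k s a|
    <= (1 - lambda) * drift t by rewrite ler_wpM2l // subr_ge0.
have d0 : 0 <= drift t by apply: le_trans qb.
have : lambda * gamma * drift t <= lambda * drift t.
  by rewrite ler_wpM2r // ler_piMr ?ltW.
lra.
Qed.

(** Averaged over agents, the kernels give exactly the global one, so Bellman's equation leaves no
    mismatch term; heterogeneity enters only through [drift], which controls each agent's value
    gap. *)
Lemma gap_succ t : (t < T)%N -> (0 < #|S|)%N ->
  gap t.+1 <= (1 - lambda) * gap t + lambda * gamma * (drift t + gamma * Y t).
Proof.
move=> tT /card_gt0P[s0 _].
have /andP[g0 g1] := g01; have /andP[l0 l1] := l01.
have vb k s := valueB s (fun s a => agent_gap_le_drift k s a (ltnW tT)).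
have c0 : 0 <= drift t + gamma * Y t by apply: le_trans (vb (Ordinal K0) s0).
apply: normQ_le => [|s a].
  by rewrite addr_ge0 // mulr_ge0 ?subr_ge0 ?normQ_ge0 // mulr_ge0 ?ltW.
rewrite avgQ_succ // gNS //.
have e : Qs s a = r s a + gamma *
    (K%:R^-1 * \sum_k \sum_z Pk k s a z * V Qs z).
  rewrite Qopt exchange_big /= [_^-1 * _]mulr_sumr; congr (_ + _ * _).
  by apply: eq_bigr => z _; rewrite -mulr_suml mulrA.
have -> : K%:R^-1 * (\sum_k noise k s a (y t k s a)) =
   K%:R^-1 * (\sum_k \sum_z Pk k s a z * V Qs z)
   - K%:R^-1 * (\sum_k V Qs (y t k s a)).
  by rewrite -mulrBr -sumrB.
(* The one-step identity with the sums replaced by scalars: Bellman's equation for [b] cancels the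
   reward and the expected value [n]. *)
have -> : forall avg n b vq vs : R,
   b = r s a + gamma * n -> b - ((1 - lambda) * avg + lambda * (r s a + gamma * vq))
   - gamma * ((1 - lambda) * gN t s a + lambda * (n - vs))
   = (1 - lambda) * (b - avg - gamma * gN t s a) + lambda * gamma * (vs - vq).
- move=> avg n b vq vs ->; ring.
- rewrite -mulrBr -sumrB.
  apply: le_trans (ler_normD _ _) _; apply: lerD.
    rewrite normrM ger0_norm ?subr_ge0 // ler_wpM2l ?subr_ge0 //.
    exact: (normQ_ub (fun s a =>
      Qs s a - avgQ a0 E gamma lambda r Q0 y t s a - gamma * gN t s a)).
  rewrite normrM gtr0_norm ?mulr_gt0 // ler_pM2l ?mulr_gt0 //.
  by apply: mean_le.
- exact: e.
Qed.

End Pathwise.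

(** * Exponential moments on a finite product space *)

Section ProductSpace.
Variables (R : realType) (I S : finType) (p : I -> S -> R).
Hypothesis p_ge0 : forall i s, 0 <= p i s.
Hypothesis p_sum1 : forall i, \sum_s p i s = 1.
Implicit Types (x : {ffun I -> S}) (f Z : {ffun I -> S} -> R).

Definition weight x : R := \prod_i p i (x i).

Definition expect f : R := \sum_x weight x * f x.

Lemma weight_ge0 x : 0 <= weight x.
Proof. by apply: prodr_ge0 => i _; exact: p_ge0. Qed.

Lemma expect_le f1 f2 : (forall x, f1 x <= f2 x) -> expect f1 <= expect f2.
Proof. by move=> h; apply: ler_sum => x _; rewrite ler_wpM2l ?weight_ge0. Qed.

(** Expanding a product of sums over all choice functions: independence of the coordinates in finite
    form. *)
Lemma expect_prod (h : I -> S -> R) :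
  expect (fun x => \prod_i h i (x i)) = \prod_i \sum_s p i s * h i s.
Proof.
rewrite bigA_distr_bigA /=; apply: eq_bigr => x _.
by rewrite /weight -big_split.
Qed.

Lemma sum_weight : \sum_x weight x = 1.
Proof. by rewrite /weight -bigA_distr_bigA big1. Qed.

Lemma expect_cst (c : R) : expect (fun=> c) = c.
Proof. by rewrite /expect -mulr_suml sum_weight mul1r. Qed.

Lemma expect_sum (J : finType) (f : J -> {ffun I -> S} -> R) :
  expect (fun x => \sum_j f j x) = \sum_j expect (f j).
Proof.
rewrite /expect exchange_big /=; apply: eq_bigr => x _; exact: mulr_sumr.
Qed.

Lemma expectD f1 f2 : expect (fun x => f1 x + f2 x) = expect f1 + expect f2.
Proof. by rewrite -big_split /=; apply: eq_bigr => x _; rewrite mulrDr. Qed.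

Lemma expectZ c f : expect (fun x => c * f x) = c * expect f.
Proof. by rewrite /expect mulr_sumr; apply: eq_bigr => x _; rewrite mulrCA. Qed.

Section Subgaussian.
Variables (n : I -> S -> R) (b : R).
Hypothesis n_le : forall i s, `|n i s| <= b.
Hypothesis n_mean0 : forall i, \sum_s p i s * n i s = 0.

(** Independence factors the exponential; in each factor [expR_le_quad] leaves a linear term of mean
    zero. *)
Lemma mgf_linear (a : I -> R) :
  expect (fun x => expR (\sum_i a i * n i (x i)))
  <= expR (3 / 2 * (b ^+ 2 * \sum_i a i ^+ 2)).
Proof.
rewrite (_ : (fun x => _) =
    fun x : {ffun I -> S} => \prod_i expR (a i * n i (x i))); last first.
  by apply/funext => x; rewrite expR_sum.
rewrite (expect_prod (fun i s => expR (a i * n i s))) !mulr_sumr expR_sum.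
apply: ler_prod => i _; apply/andP; split.
  by apply: sumr_ge0 => s _; rewrite mulr_ge0 ?expR_ge0.
apply: (@le_trans _ _ (\sum_s (a i * (p i s * n i s)
    + p i s * expR (3 / 2 * (b ^+ 2 * a i ^+ 2))))).
  apply: ler_sum => s _; rewrite mulrCA -mulrDr ler_wpM2l //.
  apply: le_trans (expR_le_quad _) _; rewrite lerD2l ler_expR ler_pM2l //.
  rewrite exprMn mulrC ler_wpM2r ?sqr_ge0 //.
  by rewrite -real_normK ?num_real // lerXn2r ?nnegrE // (le_trans _ (n_le i s)).
by rewrite big_split /= -mulr_sumr n_mean0 mulr0 add0r -mulr_suml p_sum1 mul1r.
Qed.

(** The maximum is attained at some [j], and the exponential of an absolute value is at most the sum
    over both signs; summing over all [j] costs the factor [2 * #|J|]. *)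
Lemma mgf_bigmax (J : finType) (a : J -> I -> R) (v s : R) : (0 < #|J|)%N ->
  (forall j, \sum_i a j i ^+ 2 <= v) ->
  expect (fun x => expR (s * \big[Num.max/0]_j `|\sum_i a j i * n i (x i)|))
  <= 2 * #|J|%:R * expR (3 / 2 * (b ^+ 2 * (s ^+ 2 * v))).
Proof.
move=> /card_gt0P[j0 _] av.
have e c j : c ^+ 2 = s ^+ 2 ->
   expect (fun x => expR (c * \sum_i a j i * n i (x i)))
   <= expR (3 / 2 * (b ^+ 2 * (s ^+ 2 * v))).
  move=> cs; rewrite (_ : (fun x => _) =
      fun x : {ffun I -> S} => expR (\sum_i (c * a j i) * n i (x i))).
    apply: le_trans (mgf_linear _) _; rewrite ler_expR ler_pM2l //.
    rewrite ler_wpM2l ?sqr_ge0 // -cs (eq_bigr (fun i => c ^+ 2 * a j i ^+ 2)).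
      by rewrite -mulr_sumr ler_wpM2l ?sqr_ge0.
    by move=> i _; rewrite exprMn.
  by apply/funext => x; rewrite mulr_sumr; under eq_bigr do rewrite mulrA.
apply: (@le_trans _ _ (expect (fun x => \sum_j
    (expR (s * \sum_i a j i * n i (x i)) + expR (- s * \sum_i a j i * n i (x i)))))).
  apply: expect_le => x.
  have [j _ ->] := @eq_bigmax _ _ _ 0 j0 predT
    (fun j => `|\sum_i a j i * n i (x i)|) isT (fun _ _ => normr_ge0 _).
  rewrite (bigD1 j) //= -[leLHS]addr0; apply: lerD; last first.
    by apply: sumr_ge0 => k _; rewrite addr_ge0 ?expR_ge0.
  have [h|h] := ger0P (\sum_i a j i * n i (x i)).
    by rewrite lerDl expR_ge0.
  by rewrite mulrN -mulNr lerDr expR_ge0.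
rewrite expect_sum.
apply: (@le_trans _ _ (\sum_(j : J) 2 * expR (3 / 2 * (b ^+ 2 * (s ^+ 2 * v))))).
  apply: ler_sum => j _; rewrite expectD mulr2n mulrDl !mul1r.
  by apply: lerD; apply: e; rewrite ?sqrrN.
by rewrite sumr_const -[leLHS]mulr_natl mulrA [_%:R * 2]mulrC.
Qed.

End Subgaussian.

(* [c] bounds the Orlicz gauge of [Z] for the convex function [expR (s * _)];
   quantifying over [c' > c] keeps the definition meaningful at [c = 0]. *)
Section Gauge.
Variables (s Psi : R).
Hypothesis Psi1 : 1 <= Psi.

Definition gauge_le Z (c : R) : Prop :=
  0 <= c /\ forall c', c < c' -> expect (fun x => expR (s * (Z x / c'))) <= Psi.

Hypothesis s0 : 0 <= s.

Lemma gauge_le_mono Z Z' c c' : (forall x, Z' x <= Z x) -> c <= c' ->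
  gauge_le Z c -> gauge_le Z' c'.
Proof.
move=> ZZ cc [c0 h]; split=> [|d cd]; first exact: le_trans cc.
have d0 : 0 < d by apply: le_lt_trans cd; apply: le_trans cc.
apply: le_trans (h d (le_lt_trans cc cd)); apply: expect_le => x.
by rewrite ler_expR ler_wpM2l // ler_wpM2r // invr_ge0 ltW.
Qed.

Lemma gauge_le0 Z : (forall x, Z x <= 0) -> gauge_le Z 0.
Proof.
move=> Z0; apply: (@gauge_le_mono (fun=> 0) _ 0) => //.
by split=> // c' _; rewrite mul0r mulr0 expR0 expect_cst.
Qed.

(** Triangle inequality: [(Z1 + Z2) / c'] is the convex combination of [Z1 / d1] and [Z2 / d2] with
    weights [d1 / c'] and [d2 / c']. It holds under arbitrary dependence, so noises of different
    iterations can be added up. *)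
Lemma gauge_leD Z1 Z2 c1 c2 : gauge_le Z1 c1 -> gauge_le Z2 c2 ->
  gauge_le (fun x => Z1 x + Z2 x) (c1 + c2).
Proof.
move=> [c10 h1] [c20 h2]; split=> [|c' cc]; first exact: addr_ge0.
(* The slack is split equally, so that both scales are strictly admissible. *)
pose e := (c' - c1 - c2) / 2; have e0 : 0 < e by rewrite /e; lra.
have := h1 (c1 + e); rewrite ltrDl => /(_ e0) {}h1.
have := h2 (c2 + e); rewrite ltrDl => /(_ e0) {}h2.
have c'E : c' = (c1 + e) + (c2 + e) by rewrite /e; field.
move: h1 h2 c'E; set d1 := c1 + e; set d2 := c2 + e => h1 h2 c'E.
have d10 : 0 < d1 by rewrite /d1; lra.
have d20 : 0 < d2 by rewrite /d2; lra.
have c'0 : 0 < c' by lra.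
pose t := d1 / c'.
have t01 : 0 <= t <= 1.
  rewrite /t divr_ge0 ?(ltW d10) ?(ltW c'0) //=.
  by rewrite ler_pdivrMr // mul1r c'E lerDl ltW.
apply: (@le_trans _ _ (expect (fun x => t * expR (s * (Z1 x / d1))
    + (1 - t) * expR (s * (Z2 x / d2))))).
  apply: expect_le => x; apply: le_trans (expR_convex2 _ _ t01).
  rewrite ler_expR le_eqVlt; apply/orP; left; apply/eqP.
  by rewrite /t c'E; field; rewrite -c'E !gt_eqF.
rewrite expectD !expectZ.
have /andP[t0 t1] := t01.
have : t * expect (fun x => expR (s * (Z1 x / d1))) <= t * Psi by rewrite ler_wpM2l.
have : (1 - t) * expect (fun x => expR (s * (Z2 x / d2))) <= (1 - t) * Psi.
  by rewrite ler_wpM2l // subr_ge0.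
lra.
Qed.

Lemma gauge_leZ Z c k : 0 <= k -> gauge_le Z c ->
  gauge_le (fun x => k * Z x) (k * c).
Proof.
rewrite le_eqVlt => /predU1P[<- _|k0 [c0 h]].
  by rewrite mul0r; apply: gauge_le0 => x; rewrite mul0r.
split=> [|c' cc]; first by rewrite mulr_ge0 // ltW.
have := h (c' / k); rewrite ltr_pdivlMr // mulrC => /(_ cc) {}h.
rewrite (_ : (fun x => _) = fun x => expR (s * (Z x / (c' / k)))) //.
apply/funext => x; congr (expR (_ * _)).
have c'0 : 0 < c' by apply: le_lt_trans cc; rewrite mulr_ge0 // ltW.
by field; rewrite !gt_eqF.
Qed.

(** Markov's inequality for [expR (s * (Z x / c'))]. *)
Lemma gauge_tail Z c c' u : gauge_le Z c -> c < c' ->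
  \sum_(x | u < Z x) weight x <= Psi * expR (- (s * (u / c'))).
Proof.
move=> [c0 h] cc; have c'0 : 0 < c' by exact: le_lt_trans cc.
rewrite -[leLHS]mul1r -[leLHS]mulrC expRN ler_pdivlMr ?expR_gt0 // mulr1.
apply: le_trans (h _ cc); rewrite mulr_suml big_mkcond /=.
apply: ler_sum => x _; case: ifP => [uZ|_]; last first.
  by rewrite mulr_ge0 ?weight_ge0 ?expR_ge0.
rewrite ler_wpM2l ?weight_ge0 // ler_expR ler_wpM2l // ler_wpM2r ?invr_ge0 ?ltW //.
Qed.

(** * Propagation of gauges through the error recursion *)

Section Recursion.
Variables (E T : nat) (gamma lambda H d0 : R).
Variables (g d Y : nat -> {ffun I -> S} -> R).
Hypotheses (g01 : 0 < gamma < 1) (l01 : 0 < lambda <= 1) (E0 : (0 < E)%N).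
Hypotheses (lE : lambda * (E%:R - 1) <= 1) (H0 : 0 <= H) (d00 : 0 <= d0).
Hypothesis gauge_Y : forall t, gauge_le (Y t) 1.
Hypothesis g_init : forall x, g 0 x <= d0.
Hypothesis g_succ : forall t x, (t < T)%N ->
  g t.+1 x <= (1 - lambda) * g t x + lambda * gamma * (d t x + gamma * Y t x).
Hypothesis d_init : forall x, d 0 x = g 0 x + gamma * Y 0 x.
Hypothesis d_succ : forall t x, (t < T)%N -> d t.+1 x =
  if (t.+1 %% E == 0)%N then g t.+1 x + gamma * Y t.+1 x
  else d t x + lambda * gamma * (H + gamma * Y t x).

(** [rho] gives up half of the rate [(1 - gamma) * lambda], to pay for the drift being as old as the
    last synchronization. [h] and [c] are the fixed points of the heterogeneity and noise
    recursions; see [hE] and [cE]. *)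
Let rho := 1 - (1 - gamma) * lambda / 2.
Let w : R := lambda * (E%:R - 1).
Let h := gamma * (w * gamma * H) / (1 - gamma).
Let c := gamma * (2 * gamma + w * gamma ^+ 2) / (1 - gamma).

Lemma bernoulli_sub (z : R) m : 0 <= z <= 1 -> 1 - m%:R * z <= (1 - z) ^+ m.
Proof.
move=> /andP[z0 z1]; elim: m => [|m IH]; first by rewrite expr0; lra.
have m0 : 0 <= m%:R :> R by [].
rewrite exprS -natr1; have : (1 - z) * (1 - m%:R * z) <= (1 - z) * (1 - z) ^+ m.
  by rewrite ler_wpM2l // subr_ge0.
have : 0 <= m%:R * (z * z) by rewrite !mulr_ge0.
lra.
Qed.

Let modE t : (t %% E)%:R * lambda <= w.
Proof.
have /andP[l0 _] := l01; rewrite /w mulrC ler_pM2l //.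
have : (t %% E < E)%N by rewrite ltn_mod.
by rewrite -(ler_nat R) -natr1; lra.
Qed.

(** With [A = rho ^+ (t %% E)] the claim reduces to [gamma <= (1 + gamma) / 2 * A]. Bernoulli and
    [lambda * (E - 1) <= 1] give [A >= (1 + gamma) / 2], whose square is at least [gamma]. *)
Lemma rho_step t :
  (1 - lambda) * rho ^+ t + lambda * gamma * rho ^+ (t - t %% E) <= rho ^+ t.+1.
Proof.
have /andP[g0 g1] := g01; have /andP[l0 l1] := l01.
have r0 : 0 < rho by rewrite /rho; nra.
have -> : rho ^+ t.+1 = rho * (rho ^+ (t - t %% E) * rho ^+ (t %% E)).
  by rewrite -exprD subnK ?leq_mod // exprS.
have -> : rho ^+ t = rho ^+ (t - t %% E) * rho ^+ (t %% E).
  by rewrite -exprD subnK ?leq_mod.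
have : (1 + gamma) / 2 <= rho ^+ (t %% E).
  have := @bernoulli_sub ((1 - gamma) * lambda / 2) (t %% E).
  have z01 : 0 <= (1 - gamma) * lambda / 2 <= 1.
    have : 0 <= (1 - gamma) * lambda by apply: mulr_ge0; lra.
    have : 0 <= (1 - gamma) * (1 - lambda) by apply: mulr_ge0; lra.
    by move=> ? ?; apply/andP; split; lra.
  rewrite -/rho => /(_ z01) h1; apply: le_trans h1.
  have mt : (t %% E)%:R * lambda <= 1 by exact: le_trans (modE t) lE.
  have : 0 <= (1 - gamma) * (1 - (t %% E)%:R * lambda).
    by rewrite mulr_ge0 // subr_ge0 // ltW.
  lra.
set A := rho ^+ (t %% E); set B := rho ^+ _ => hA.
have B0 : 0 <= B by rewrite exprn_ge0 // ltW.
have : 0 <= lambda * B * ((1 + gamma) / 2 * A - gamma).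
  apply: mulr_ge0; first by rewrite mulr_ge0 // ltW.
  by have := sqr_ge0 (1 - gamma); nra.
by move=> hpos; rewrite [X in _ <= X * _](_ : _ = 1 - (1 - gamma) * lambda / 2) //; lra.
Qed.

Let gap_claim t := gauge_le (fun x => g t x - rho ^+ t * d0 - h) c.
(** Between synchronizations the decay is frozen at the last one, while heterogeneity and noise grow
    linearly in the [t %% E] local steps. *)
Let drift_claim t := gauge_le (fun x => d t x - rho ^+ (t - t %% E) * d0 - h
    - lambda * gamma * (t %% E)%:R * H)
  (c + gamma + lambda * gamma ^+ 2 * (t %% E)%:R).

Let w0 : 0 <= w.
Proof.
have /andP[l0 _] := l01.
by rewrite /w mulr_ge0 ?(ltW l0) // subr_ge0 ler1n.
Qed.

Let h0 : 0 <= h.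
Proof.
have /andP[g0 g1] := g01.
apply: divr_ge0; last by rewrite subr_ge0 ltW.
by apply: mulr_ge0 (ltW g0) (mulr_ge0 (mulr_ge0 w0 (ltW g0)) H0).
Qed.

Let hE : (1 - gamma) * h = gamma * (w * gamma * H).
Proof.
have /andP[g0 g1] := g01.
by rewrite /h; field; rewrite gt_eqF // subr_gt0.
Qed.

Let cE : (1 - gamma) * c = gamma * (2 * gamma + w * gamma ^+ 2).
Proof.
have /andP[g0 g1] := g01.
by rewrite /c; field; rewrite gt_eqF // subr_gt0.
Qed.

Let c0 : 0 <= c.
Proof.
have /andP[g0 g1] := g01.
rewrite /c divr_ge0 ?subr_ge0 ?(ltW g1) // mulr_ge0 ?(ltW g0) // addr_ge0 //.
  by rewrite mulr_ge0 ?(ltW g0).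
by rewrite mulr_ge0 ?sqr_ge0.
Qed.

Let sync t : gap_claim t -> (t %% E = 0)%N ->
  (forall x, d t x = g t x + gamma * Y t x) -> drift_claim t.
Proof.
have /andP[g0 g1] := g01.
move=> gt tE dt; rewrite /drift_claim tE subn0 !mulr0 addr0.
apply: gauge_le_mono (gauge_leD gt (gauge_leZ (ltW g0) (gauge_Y t))) => [x|].
  by rewrite dt mul0r subr0; lra.
by rewrite mulr1.
Qed.

Lemma gauge_recursion t : (t <= T)%N -> gap_claim t /\ drift_claim t.
Proof.
have /andP[g0 g1] := g01; have /andP[l0 l1] := l01.
have lg0 : 0 < lambda * gamma by rewrite mulr_gt0.
elim: t => [_|t IH tT].
  have g0c : gap_claim 0.
    apply: gauge_le_mono (@gauge_le0 (fun x => g 0 x - rho ^+ 0 * d0 - h) _) => //.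
    by move=> x; rewrite expr0 mul1r; have := g_init x; have := h0; lra.
  by split=> //; apply: sync => //; rewrite mod0n.
have [gt dt] := IH (ltnW tT).
have g_next : gap_claim t.+1.
  have := gauge_leD (gauge_leZ _ gt) (gauge_leZ (ltW lg0)
    (gauge_leD dt (gauge_leZ (ltW g0) (gauge_Y t)))).
  move=> /(_ (1 - lambda)); rewrite subr_ge0 => /(_ l1).
  apply: gauge_le_mono => [x|].
    have e1 : rho ^+ t.+1 * d0 >= (1 - lambda) * (rho ^+ t * d0)
        + lambda * gamma * (rho ^+ (t - t %% E) * d0).
      by rewrite !mulrA -mulrDl ler_wpM2r // rho_step.
    (* The heterogeneity gathered in at most [E - 1] local steps is what the fixed point [h]
       absorbs; [e3] is the same for the noise and [c]. *)
    have e2 : lambda * gamma * (lambda * gamma * (t %% E)%:R * H)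
        <= lambda * ((1 - gamma) * h).
      rewrite hE [leLHS](_ : _ =
        lambda * (gamma * (gamma * H * ((t %% E)%:R * lambda)))); last by ring.
      rewrite [leRHS](_ : _ = lambda * (gamma * (gamma * H * w))); last by ring.
      by rewrite ler_pM2l // ler_pM2l // ler_wpM2l // mulr_ge0 // ltW.
    have := g_succ x tT; lra.
  have e3 : lambda * gamma * (lambda * gamma ^+ 2 * (t %% E)%:R + 2 * gamma)
      <= lambda * ((1 - gamma) * c).
    rewrite cE [leLHS](_ : _ = lambda * (gamma *
      (2 * gamma + (t %% E)%:R * lambda * gamma ^+ 2))); last by ring.
    rewrite ler_pM2l // ler_pM2l // lerD2l.
    by rewrite ler_wpM2r ?sqr_ge0.
  lra.
split=> //; have [tE|tE] := eqVneq (t.+1 %% E)%N 0%N.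
  by apply: sync => // x; rewrite d_succ // tE eqxx.
have mE : (t.+1 %% E = (t %% E).+1)%N.
  by move: tE; rewrite modnS; case: ifP.
rewrite /drift_claim mE subSS.
have := gauge_leD dt (gauge_leZ (ltW lg0) (gauge_leZ (ltW g0) (gauge_Y t))).
apply: gauge_le_mono => [x|]; last by rewrite -natr1; lra.
by rewrite d_succ // (negbTE tE) -natr1; lra.
Qed.

Lemma final_gauge :
  gauge_le (fun x => g T x + gamma * Y T x - rho ^+ T * d0 - h) (c + gamma).
Proof.
have /andP[g0 g1] := g01; have [gT _] := gauge_recursion (leqnn T).
apply: gauge_le_mono (gauge_leD gT (gauge_leZ (ltW g0) (gauge_Y T))) => [x|].
  lra.
by rewrite mulr1.
Qed.

End Recursion.
End Gauge.
End ProductSpace.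

(** * Law of the samples and noise coefficients *)

Section SampleLaw.
Variables (R : realType) (S A : finType) (K T : nat).
Variable Pk : 'I_K -> S -> A -> S -> R.
Variables (d : measure_display) (Omega : measurableType d).
Variables (Pr : probability Omega R) (X : nat -> 'I_K -> S -> A -> Omega -> S).

Let I : finType := ('I_T * 'I_K * S * A)%type.

Definition sample_kernel (z : I) : S -> R := Pk z.1.1.2 z.1.2 z.2.

Definition samples (w : Omega) : {ffun I -> S} :=
  [ffun z : I => X z.1.1.1 z.1.1.2 z.1.2 z.2 w].

(** The event of one sample array is an intersection of singleton events, of probability [weight] by
    independence; finite disjoint unions give every [G]. Probabilities thus become finite sums. *)
Lemma samples_law (G : pred {ffun I -> S}) : generative_samples Pr T Pk X ->
  Pr [set w | G (samples w)] = (\sum_(x | G x) weight sample_kernel x)%:E.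
Proof.
move=> [mX lawX indX].
have cellE x : [set w | samples w = x] = \bigcap_(z in [set` [set: I]%SET])
    ((fun w => X z.1.1.1 z.1.1.2 z.1.2 z.2 w) @^-1` [set x z]).
  apply/seteqP; split=> w /=; first by move=> <- z _ /=; rewrite ffunE.
  by move=> h; apply/ffunP => z; rewrite ffunE; apply: h; rewrite /= inE.
have mcell x : measurable [set w | samples w = x].
  by rewrite cellE; apply: fin_bigcap_measurable => // z _; exact: mX.
have Pcell x : Pr [set w | samples w = x] = (weight sample_kernel x)%:E.
  rewrite cellE; have := indX [set: I]%SET (fun z => [set x z]) => ->.
  rewrite /weight -prodEFin; apply: eq_big => z; first by rewrite inE.
  by move=> _; exact: lawX.
have main (s : seq {ffun I -> S}) : uniq s ->
    measurable [set w | samples w \in s] /\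
    Pr [set w | samples w \in s] = (\sum_(x <- s) weight sample_kernel x)%:E.
  elim: s => [_|x s IH /= /andP[xs us]].
    rewrite (_ : [set w | _] = set0) ?big_nil ?measure0 //.
    by apply/seteqP; split => w.
  have [ms Ps] := IH us.
  rewrite (_ : [set w | _] =
      [set w | samples w = x] `|` [set w | samples w \in s]); last first.
    apply/seteqP; split=> w /=; rewrite in_cons; first by case/predU1P; [left|right].
    by case=> [->|->]; rewrite ?eqxx ?orbT.
  split; first exact: measurableU.
  rewrite measureU // ?big_cons; first by rewrite EFinD -Pcell -Ps.
  by apply/seteqP; split=> w //= [-> ]; rewrite (negbTE xs).
have [_] := main (enum G) (enum_uniq _).
rewrite big_enum /= => <-; congr (Pr _).
by apply/seteqP; split=> w /=; rewrite mem_enum.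
Qed.

End SampleLaw.

Section Locality.
Variables (R : realType) (S A : finType) (a0 : A) (K E : nat).
Variables (gamma lambda : R) (r Q0 : S -> A -> R).

(** Iterates at time [t] read only earlier draws, so a run on the family [X] agrees up to [T] with a
    run on the finite array of draws. *)
Lemma fedQ_local (y y' : nat -> 'I_K -> S -> A -> S) t :
  (forall u, (u < t)%N -> y u = y' u) ->
  fedQ a0 E gamma lambda r Q0 y t = fedQ a0 E gamma lambda r Q0 y' t.
Proof.
elim: t => // t IH yy /=; rewrite IH ?yy // => u ut.
by apply: yy; rewrite ltnS ltnW.
Qed.

Lemma avgQ_local (y y' : nat -> 'I_K -> S -> A -> S) t :
  (forall u, (u < t)%N -> y u = y' u) ->
  avgQ a0 E gamma lambda r Q0 y t = avgQ a0 E gamma lambda r Q0 y' t.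
Proof. by move=> /fedQ_local; rewrite /avgQ => ->. Qed.

End Locality.

(** * Variance proxies of the accumulated noises *)

Section Coefficients.
Variables (R : realType) (S A : finType) (K T E : nat) (lambda : R).
Hypotheses (K0 : (0 < K)%N) (E0 : (0 < E)%N) (l01 : 0 < lambda <= 1).
Hypothesis lEK : lambda * (E%:R - 1) <= K%:R^-1.

Let I : finType := ('I_T * 'I_K * S * A)%type.

Definition hits (t : nat) (s : S) (a : A) (z : I) : bool :=
  [&& z.1.1.1 == t :> nat, z.1.2 == s & z.2 == a].

(* Coefficients of the accumulated noise in the individual sampling errors:
   index [None] is the averaged noise, index [Some k] is the noise of agent
   [k] since the last synchronization. *)
Fixpoint coef (t : nat) (j : option 'I_K * S * A) (z : I) : R :=
  if t is u.+1 then
    match j.1.1 with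
    | None => (1 - lambda) * coef u j z
              + lambda * K%:R^-1 * (hits u j.1.2 j.2 z)%:R
    | Some k => if (u.+1 %% E == 0)%N then 0
                else (1 - lambda) * coef u j z
                     + lambda * (hits u j.1.2 j.2 z && (z.1.1.2 == k))%:R
    end
  else 0.

Lemma coef_future t j (z : I) : (t <= z.1.1.1)%N -> coef t j z = 0.
Proof.
elim: t => //= t IH tz; rewrite IH ?(ltnW tz) //.
have -> : hits t j.1.2 j.2 z = false by rewrite /hits gtn_eqF.
by case: j.1.1 => [k|] /=; rewrite !mulr0 addr0 //; case: ifP.
Qed.

Lemma sum_hits t s a (F : I -> R) (tT : (t < T)%N) :
  \sum_(z : I) (hits t s a z)%:R * F z = \sum_k F (Ordinal tT, k, s, a).
Proof.
rewrite (eq_bigr (fun z => if hits t s a z then F z else 0)); last first.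
  by move=> z _; case: ifP; rewrite ?mul1r ?mul0r.
rewrite -big_mkcond (reindex_onto (fun k => (Ordinal tT, k, s, a) : I)
  (fun z => z.1.1.2)) /=.
  by apply: eq_bigl => k; rewrite /hits /= !eqxx.
move=> [[[i k] s'] a'] /= /and3P[/eqP it /eqP /= -> /eqP /= ->].
by congr (_, _, _, _); apply: val_inj.
Qed.

Lemma sum_hits_agent t k s a (F : I -> R) (tT : (t < T)%N) :
  \sum_(z : I) (hits t s a z && (z.1.1.2 == k))%:R * F z = F (Ordinal tT, k, s, a).
Proof.
under eq_bigr do rewrite -mulnb natrM -mulrA.
rewrite (sum_hits s a (fun z => (z.1.1.2 == k)%:R * F z) tT) (bigD1 k) //=.
rewrite eqxx mul1r big1 ?addr0 // => k' /negbTE ->; exact: mul0r.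
Qed.

Lemma sum_hits_late t s a (b : pred I) : (T <= t)%N ->
  \sum_(z : I) (hits t s a z && b z)%:R = 0 :> R.
Proof.
move=> Tt; apply: big1 => z _; rewrite /hits ltn_eqF //.
by apply: leq_trans Tt.
Qed.

(** A fresh sample has had coefficient zero so far ([coef_future]), so squaring produces no cross
    term. *)
Let sq_step (c e : R) (b : bool) : (b -> c = 0) ->
  ((1 - lambda) * c + e * b%:R) ^+ 2
  = (1 - lambda) ^+ 2 * c ^+ 2 + e ^+ 2 * b%:R.
Proof.
case: b => [/(_ isT) ->|_]; last by rewrite !mulr0 !addr0 exprMn.
by rewrite mulr0 add0r expr0n /= mulr0 add0r !mulr1.
Qed.

(** Each step multiplies the sum of squares by [(1 - lambda) ^+ 2] and adds at most
    [lambda ^+ 2 / K], from [K] samples of weight [lambda / K]; the bound persists since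
    [(1 - lambda) ^+ 2 + lambda <= 1]. *)
Lemma coef_sq_global t s a :
  \sum_(z : I) coef t (None, s, a) z ^+ 2 <= lambda * K%:R^-1.
Proof.
have /andP[l0 l1] := l01; have K0' : 0 < K%:R^-1 :> R by rewrite invr_gt0 ltr0n.
elim: t => [|t IH] /=.
  by rewrite big1 ?mulr_ge0 ?ltW // => z _; rewrite expr0n.
under eq_bigr => z _.
  rewrite sq_step; last by move=> /and3P[/eqP zt _ _]; rewrite coef_future ?zt.
  over.
rewrite big_split /= -!mulr_sumr.
have cnt : \sum_(z : I) (hits t s a z)%:R <= K%:R :> R.
  have [tT|Tt] := ltnP t T.
    under eq_bigr do rewrite -[_%:R]mulr1.
    by rewrite (sum_hits s a (fun=> 1) tT) sumr_const card_ord.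
  have := sum_hits_late s a predT Tt; under eq_bigr do rewrite andbT.
  by move=> ->.
have e2 : (lambda * K%:R^-1) ^+ 2 * \sum_(z : I) (hits t s a z)%:R
    <= lambda ^+ 2 * K%:R^-1.
  apply: le_trans (ler_wpM2l (sqr_ge0 _) cnt) _.
  by rewrite exprMn -mulrA [_^-1 ^+ 2]expr2 mulfVK // gt_eqF ?ltr0n.
have : (1 - lambda) ^+ 2 * \sum_(z : I) coef t (None, s, a) z ^+ 2
    <= (1 - lambda) ^+ 2 * (lambda * K%:R^-1) by rewrite ler_wpM2l ?sqr_ge0.
have : 0 <= lambda * K%:R^-1 * (lambda * (1 - lambda)).
  by rewrite !mulr_ge0 ?subr_ge0 // ltW.
lra.
Qed.

Lemma coef_sq_local t k s a :
  \sum_(z : I) coef t (Some k, s, a) z ^+ 2 <= lambda ^+ 2 * (t %% E)%:R.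
Proof.
have /andP[l0 l1] := l01.
elim: t => [|t IH] /=.
  by rewrite mod0n mulr0 big1 // => z _; rewrite expr0n.
have [tE|tE] := eqVneq (t.+1 %% E)%N 0%N.
  by rewrite big1 => [|z _]; rewrite ?expr0n // mulr_ge0 ?exprn_ge0 ?(ltW l0).
under eq_bigr => z _.
  rewrite sq_step; last first.
    by move=> /andP[/and3P[/eqP zt _ _] _]; rewrite coef_future ?zt.
  over.
rewrite big_split /= -!mulr_sumr.
have cnt : \sum_(z : I) (hits t s a z && (z.1.1.2 == k))%:R <= 1 :> R.
  have [tT|Tt] := ltnP t T; last by rewrite sum_hits_late.
  under eq_bigr do rewrite -[_%:R]mulr1.
  by rewrite (sum_hits_agent k s a (fun=> 1) tT).
have mE : (t.+1 %% E = (t %% E).+1)%N.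
  by move: tE; rewrite modnS; case: ifP.
rewrite mE -natr1 mulrDr; apply: lerD; last by rewrite ler_wpM2l ?sqr_ge0.
apply: le_trans IH; rewrite ler_piMl ?sumr_ge0 // => [z _|]; first exact: sqr_ge0.
by rewrite expr_le1 // ?subr_ge0 //; lra.
Qed.

(** One variance proxy serves both kinds of noise: the local one, at most [lambda ^+ 2 * (E - 1)],
    is below [lambda / K] by [lEK]. *)
Lemma coef_sq t j : \sum_(z : I) coef t j z ^+ 2 <= lambda * K%:R^-1.
Proof.
have /andP[l0 l1] := l01.
case: j => [[[k|] s] a]; last exact: coef_sq_global.
apply: le_trans (coef_sq_local _ _ _ _) _; rewrite expr2 -mulrA ler_pM2l //.
apply: le_trans lEK; rewrite ler_pM2l //.
by rewrite lerBrDr natr1 ler_nat ltn_mod.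
Qed.

End Coefficients.

(** * High-probability error bound *)

Lemma heterogeneity_value_gap (R : realType) (S A : finType) (a0 : A) (K : nat)
    (Pk : 'I_K -> S -> A -> S -> R) (Q : S -> A -> R) (k : 'I_K) s a :
  `|\sum_z (global_kernel Pk s a z - Pk k s a z) * maxQ a0 Q z|
  <= heterogeneity Pk * normQ Q.
Proof.
apply: le_trans (ler_norm_sum _ _ _) _.
apply: (@le_trans _ _
    ((\sum_z `|global_kernel Pk s a z - Pk k s a z|) * normQ Q)).
  rewrite mulr_suml; apply: ler_sum => z _.
  by rewrite normrM ler_wpM2l // maxQ_bound // => a'; exact: normQ_ub.
rewrite ler_wpM2r ?normQ_ge0 //.
exact: (le_bigmax _ (fun z : 'I_K * S * A => \sum_(s' : S)
  `|global_kernel Pk z.1.2 z.2 s' - Pk z.1.1 z.1.2 z.2 s'|) (k, s, a)).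
Qed.

Lemma noise_le (R : realType) (S A : finType) (a0 : A) (K : nat)
    (Pk : 'I_K -> S -> A -> S -> R) (Q : S -> A -> R) k s a s' :
  transition_kernel (Pk k) -> `|noise a0 Q Pk k s a s'| <= 2 * normQ Q.
Proof.
move=> [p0 p1]; have V z : `|maxQ a0 Q z| <= normQ Q.
  by apply: maxQ_bound => a'; exact: normQ_ub.
rewrite /noise mulr2n mulrDl mul1r; apply: le_trans (ler_normB _ _) _.
by apply: lerD => //; exact: kernel_sum_le.
Qed.

Lemma noise_mean0 (R : realType) (S A : finType) (a0 : A) (K : nat)
    (Pk : 'I_K -> S -> A -> S -> R) (Q : S -> A -> R) k s a :
  transition_kernel (Pk k) ->
  \sum_s' Pk k s a s' * noise a0 Q Pk k s a s' = 0.
Proof.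
move=> [_ p1]; rewrite /noise; under eq_bigr do rewrite mulrBr.
by rewrite sumrB -mulr_suml p1 mul1r subrr.
Qed.

Section Accuracy.
Variables (R : realType) (S A : finType) (a0 : A) (K E T : nat).
Variables (gamma lambda eps : R) (r : S -> A -> R).
Variables (Pk : 'I_K -> S -> A -> S -> R) (Q0 Qs : S -> A -> R).
Hypotheses (S0 : (0 < #|S|)%N) (K0 : (0 < K)%N) (E0 : (0 < E)%N).
Hypotheses (g01 : 0 < gamma < 1) (l0 : 0 < lambda) (eps0 : 0 < eps).
Hypothesis r01 : forall s a, 0 <= r s a <= 1.
Hypothesis Pker : forall k, transition_kernel (Pk k).
Hypothesis Q0b : forall s a, 0 <= Q0 s a <= (1 - gamma)^-1.
Hypothesis Qopt : optimal_Q a0 (global_kernel Pk) gamma r Qs.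
Hypothesis lE : E%:R - 1 <=
  lambda^-1 * Num.min ((1 - gamma) / (4%:R * gamma)) K%:R^-1.
Hypothesis lE1 : lambda <= E%:R^-1.

Let I : finType := ('I_T * 'I_K * S * A)%type.
Let J : finType := (option 'I_K * S * A)%type.
Let w : R := lambda * (E%:R - 1).
Let H : R := heterogeneity Pk * (1 - gamma)^-1.
Let p : I -> S -> R := @sample_kernel R S A K T Pk.

(** Extends the finite array to all iterations; from [T] on the value [s] is a placeholder. *)
Definition draws (x : {ffun I -> S}) (t : nat) (k : 'I_K) (s : S) (a : A) : S :=
  if insub t is Some i then x (i, k, s, a) else s.

Definition draw_noise (z : I) : S -> R := noise a0 Qs Pk z.1.1.2 z.1.2 z.2.

Definition noise_sum (t : nat) (j : J) (x : {ffun I -> S}) : R :=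
  \sum_z coef E lambda t j z * draw_noise z (x z).

Definition noise_max (t : nat) (x : {ffun I -> S}) : R :=
  \big[Num.max/0]_j `|noise_sum t j x|.

Let l01 : 0 < lambda <= 1.
Proof.
rewrite l0 /=; apply: le_trans lE1 _; rewrite invf_le1 ?ltr0n //.
by rewrite ler1n.
Qed.

Let w_min : w <= Num.min ((1 - gamma) / (4%:R * gamma)) K%:R^-1.
Proof. by rewrite /w mulrC -ler_pdivlMr // mulrC. Qed.

Let wK : w <= K%:R^-1.
Proof. by move: w_min; rewrite le_min => /andP[]. Qed.

Let w_gamma : w * gamma <= (1 - gamma) / 4.
Proof.
have /andP[g0 g1] := g01.
move: w_min; rewrite le_min => /andP[wg _].
have := ler_wpM2r (ltW g0) wg.
by rewrite [leRHS](_ : _ = (1 - gamma) / 4) //; field; rewrite gt_eqF.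
Qed.

Let w0 : 0 <= w.
Proof. by rewrite /w mulr_ge0 ?(ltW l0) // subr_ge0 ler1n. Qed.

Let Qs_bound : normQ Qs <= (1 - gamma)^-1.
Proof. exact: optimal_Q_bound (global_kernel_kernel K0 Pker) g01 r01 Qopt. Qed.

Let H0 : 0 <= H.
Proof.
have /andP[_ g1] := g01.
by rewrite mulr_ge0 ?invr_ge0 ?subr_ge0 ?(ltW g1) // bigmax_ge_id.
Qed.

Lemma noise_sum_succ_avg t s a x : (t < T)%N ->
  noise_sum t.+1 (None, s, a) x = (1 - lambda) * noise_sum t (None, s, a) x
  + lambda * (K%:R^-1 * \sum_k noise a0 Qs Pk k s a (draws x t k s a)).
Proof.
move=> tT; rewrite /noise_sum /=.
under eq_bigr do rewrite mulrDl -!mulrA.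
rewrite big_split /= -!mulr_sumr; congr (_ + _ * (_ * _)).
rewrite (sum_hits s a (fun z => draw_noise z (x z)) tT); apply: eq_bigr => k _.
by rewrite /draws insubT.
Qed.

Lemma noise_sum_succ_agent t k s a x : (t < T)%N ->
  noise_sum t.+1 (Some k, s, a) x = if (t.+1 %% E == 0)%N then 0 else
  (1 - lambda) * noise_sum t (Some k, s, a) x
  + lambda * noise a0 Qs Pk k s a (draws x t k s a).
Proof.
move=> tT; rewrite /noise_sum /=; case: eqVneq => tE.
  by apply: big1 => z _; rewrite mul0r.
under eq_bigr do rewrite mulrDl -!mulrA.
rewrite big_split /= -!mulr_sumr; congr (_ + _ * _).
rewrite (sum_hits_agent k s a (fun z => draw_noise z (x z)) tT).
by rewrite /draws insubT.
Qed.

Lemma noise_sum_le_max t j x : `|noise_sum t j x| <= noise_max t x.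
Proof. exact: (le_bigmax _ (fun j => `|noise_sum t j x|)). Qed.

Lemma J_gt0 : (0 < #|J|)%N.
Proof.
by rewrite !card_prod card_option !muln_gt0 S0 /=; apply/card_gt0P; exists a0.
Qed.

Let p_ge0 i s : 0 <= p i s.
Proof. by have [h _] := Pker i.1.1.2; exact: h. Qed.

Let p_sum1 i : \sum_s p i s = 1.
Proof. by have [_ h] := Pker i.1.1.2; exact: h. Qed.

(** Twice the bound on values. It dominates a sampling error, the initial gap, and the gauge of the
    final error ([gauge_bound_lt]). *)
Let b : R := 2 / (1 - gamma).

Lemma mgf_noise_max s t :
  expect p (fun x => expR (s * noise_max t x))
  <= 2 * #|J|%:R * expR (3 / 2 * (b ^+ 2 * (s ^+ 2 * (lambda * K%:R^-1)))).
Proof.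
apply: (mgf_bigmax p_ge0 p_sum1 (n := draw_noise) _ _ _ J_gt0) => [z s'|z|j].
- apply: le_trans (noise_le _ _ _ _ _ (Pker _)) _.
  by rewrite /b ler_pM2l.
- exact: noise_mean0.
- exact: coef_sq.
Qed.

Section Tail.
Variable s : R.
Hypothesis s0 : 0 <= s.
Let Psi := 2 * #|J|%:R * expR (3 / 2 * (b ^+ 2 * (s ^+ 2 * (lambda * K%:R^-1)))).

Lemma Psi_ge1 : 1 <= Psi.
Proof.
have J1 : 1 <= #|J|%:R :> R by rewrite ler1n J_gt0.
have e1 : 1 <= expR (3 / 2 * (b ^+ 2 * (s ^+ 2 * (lambda * K%:R^-1)))).
  rewrite -[leLHS]expR0 ler_expR; apply: mulr_ge0; first lra.
  by rewrite mulr_ge0 ?sqr_ge0 // mulr_ge0 ?sqr_ge0 // mulr_ge0 ?invr_ge0 ?(ltW l0).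
move: J1 e1; rewrite /Psi; move: #|_|%:R (expR _) => m e m1 e1.
by have := ler_pM ler01 ler01 m1 e1; lra.
Qed.

Lemma gauge_noise_max t : gauge_le p s Psi (noise_max t) 1.
Proof.
split=> // c' c1; have c0 : 0 < c' by exact: lt_trans c1.
apply: le_trans (mgf_noise_max s t); apply: expect_le => // x.
rewrite ler_expR ler_wpM2l // ler_pdivrMr // ler_peMr ?(ltW c1) //.
exact: bigmax_ge_id.
Qed.

Let rho := 1 - (1 - gamma) * lambda / 2.
Let h := gamma * (w * gamma * H) / (1 - gamma).

Definition error (x : {ffun I -> S}) : R := normQ (fun s a =>
  Qs s a - avgQ a0 E gamma lambda r Q0 (draws x) T s a).

(** Instantiates the abstract recursion with the pathwise [gap] and [drift]; adding back the
    averaged noise at time [T] accounts for the last [gamma]. *)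
Lemma gauge_error :
  gauge_le p s Psi (fun x => error x - rho ^+ T * b - h)
    (gamma * (2 * gamma + w * gamma ^+ 2) / (1 - gamma) + gamma).
Proof.
have /andP[g0 g1] := g01.
pose gN x t s a := noise_sum t (None, s, a) x.
pose lN x t k s a := noise_sum t (Some k, s, a) x.
pose g t x := gap a0 E gamma lambda r Q0 Qs (draws x) (gN x) t.
pose d t x := drift a0 E gamma lambda r Q0 Qs (draws x) (gN x)
  (fun t => noise_max t x) H t.
have gN0 x s' a : gN x 0 s' a = 0 by apply: big1 => z _; rewrite mul0r.
have lN0 x k s' a : lN x 0 k s' a = 0 by apply: big1 => z _; rewrite mul0r.
have Hle k s' a : `|\sum_z (global_kernel Pk s' a z - Pk k s' a z) *
    maxQ a0 Qs z| <= H.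
  apply: le_trans (heterogeneity_value_gap _ _ _ _ _ _) _.
  by rewrite ler_wpM2l // bigmax_ge_id.
have lw1 : lambda * (E%:R - 1) <= 1.
  by apply: le_trans wK _; rewrite invf_le1 ?ltr0n // ler1n.
have b0 : 0 <= b by rewrite /b divr_ge0 // subr_ge0 ltW.
have g_init x : g 0 x <= b.
  apply: normQ_le => // s' a; rewrite gN0 mulr0 subr0 /avgQ /= mean_const //.
  rewrite /b mulr2n mulrDl mul1r; apply: le_trans (ler_normB _ _) _.
  apply: lerD; first exact: le_trans (normQ_ub _ _ _) Qs_bound.
  by have /andP[? ?] := Q0b s' a; rewrite ger0_norm.
have g_succ t x : (t < T)%N -> g t.+1 x <=
    (1 - lambda) * g t x + lambda * gamma * (d t x + gamma * noise_max t x).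
  move=> tT; apply: (@gap_succ _ _ _ _ _ _ _ _ _ _ _ Pk _ T (gN x) (lN x)) => //.
  - by move=> u s' a uT; exact: noise_sum_succ_avg.
  - by move=> u k s' a uT; exact: noise_sum_succ_agent.
  - by move=> u s' a; exact: noise_sum_le_max.
  - by move=> u k s' a; exact: noise_sum_le_max.
have := @final_gauge R I S p p_ge0 p_sum1 s Psi Psi_ge1 s0 E T gamma lambda H b
  g d noise_max g01 l01 E0 lw1 H0 b0 gauge_noise_max g_init g_succ.
move=> /(_ (fun _ => erefl) (fun _ _ _ => erefl)) /=.
apply: gauge_le_mono => // x.
suff : error x <= g T x + gamma * noise_max T x by rewrite /rho /h /w; lra.
have gT0 : 0 <= g T x by exact: normQ_ge0.
have nT0 : 0 <= noise_max T x by exact: bigmax_ge_id.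
apply: normQ_le => [|s' a]; first by rewrite addr_ge0 ?mulr_ge0 ?(ltW g0).
rewrite -[_ - avgQ _ _ _ _ _ _ _ _ _ _](subrK (gamma * gN x T s' a)).
apply: le_trans (ler_normD _ _) _; apply: lerD.
  exact: (normQ_ub (fun s a =>
    Qs s a - avgQ a0 E gamma lambda r Q0 (draws x) T s a - gamma * gN x T s a)).
by rewrite normrM gtr0_norm // ler_pM2l // noise_sum_le_max.
Qed.

End Tail.

(** By [w_gamma], the gap times [1 - gamma] is at least [(1 - gamma) * (2 + gamma - gamma ^+ 2 /
    4)]. Strictness is what [gauge_tail] asks for. *)
Lemma gauge_bound_lt :
  gamma * (2 * gamma + w * gamma ^+ 2) / (1 - gamma) + gamma < b.
Proof.
have /andP[g0 g1] := g01; have g1' : 0 < 1 - gamma by rewrite subr_gt0.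
rewrite /b -(ltr_pM2r g1') mulrDl !divfK ?gt_eqF //.
have : gamma ^+ 2 * (w * gamma) <= gamma ^+ 2 * ((1 - gamma) / 4).
  by rewrite ler_wpM2l ?sqr_ge0.
have : 0 < (1 - gamma) * (2 + gamma - gamma ^+ 2 / 4) by rewrite mulr_gt0 //; nra.
lra.
Qed.

Variables (delta : R) (d : measure_display) (Omega : measurableType d).
Variables (Pr : probability Omega R) (X : nat -> 'I_K -> S -> A -> Omega -> S).
Hypothesis d01 : 0 < delta < 3%:R^-1.
Hypothesis Xlaw : generative_samples Pr T Pk X.

Let M : R := (#|S| * #|A| * K)%:R.

(** The bias takes two thirds of [eps]; a Chernoff bound handles a noise excess of [eps / 3]. *)
Lemma error_tail :
  (1 - (1 - gamma) * lambda / 2) ^+ T * b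
  + gamma * (w * gamma * H) / (1 - gamma) <= 2 / 3 * eps ->
  2304%:R * (lambda * ln (M / delta)) <= eps ^+ 2 * (1 - gamma) ^+ 4 * K%:R ->
  \sum_(x | eps < error x) weight p x <= 3 * delta.
Proof.
move=> hbias hnoise.
have /andP[g0 g1] := g01; have g1' : 0 < 1 - gamma by rewrite subr_gt0.
have /andP[dl0 dl1] := d01.
have K0' : 0 < K%:R :> R by rewrite ltr0n.
have A0 : (0 < #|A|)%N by apply/card_gt0P; exists a0.
have M1 : 1 <= M by rewrite /M ler1n !muln_gt0 S0 A0.
have M0 : 0 < M by lra.
pose u := eps / 3 / b; pose v := 3 / 2 * (b ^+ 2 * (lambda * K%:R^-1)).
have b0 : 0 < b by rewrite /b divr_gt0.
have v0 : 0 < v by rewrite /v !mulr_gt0 ?exprn_gt0 ?invr_gt0.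
have u0 : 0 < u by rewrite /u !divr_gt0.
(* Minimizer of [s ^+ 2 * v - s * u], with value [- (u ^+ 2 / (4 * v))]. *)
pose s := u / (2 * v).
have s0 : 0 <= s by apply: divr_ge0; [exact: ltW | rewrite mulr_ge0 ?(ltW v0)].
have := gauge_tail p_ge0 s0 (eps / 3) (gauge_error s0) gauge_bound_lt.
move=> tail; apply: le_trans (le_trans tail _).
  rewrite [leLHS]big_mkcond [leRHS]big_mkcond /=; apply: ler_sum => x _.
  case: ifP => [ex|_]; last by case: ifP => // _; exact: weight_ge0.
  by rewrite ifT //; move: hbias ex; lra.
rewrite -mulrA -expRD.
have -> : 3 / 2 * (b ^+ 2 * (s ^+ 2 * (lambda * K%:R^-1))) - s * (eps / 3 / b)
    = - (u ^+ 2 / (4 * v)).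
  have -> : 3 / 2 * (b ^+ 2 * (s ^+ 2 * (lambda * K%:R^-1))) = s ^+ 2 * v.
    by rewrite /v; ring.
  by rewrite -/u /s; field; rewrite gt_eqF.
set a := ln (M / delta) in hnoise.
(* The constant required is [48 * 36 = 1728], below 2304. The factor 2 yields [(delta / M) ^+ 2], so
   that one [M] absorbs the cardinality of [J]. *)
have ua : 2 * a <= u ^+ 2 / (4 * v).
  rewrite ler_pdivlMr; last exact: mulr_gt0.
  have -> : u ^+ 2 = eps ^+ 2 * (1 - gamma) ^+ 2 / 36.
    by rewrite /u /b; field; rewrite !gt_eqF.
  have -> : 2 * a * (4 * v) = 48 * (lambda * a) / ((1 - gamma) ^+ 2 * K%:R).
    by rewrite /v /b; field; rewrite !gt_eqF.
  rewrite ler_pdivrMr ?mulr_gt0 ?exprn_gt0 //.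
  have e4 : 0 <= eps ^+ 2 * (1 - gamma) ^+ 4 * K%:R.
    by rewrite !mulr_ge0 ?exprn_ge0 // ltW.
  have -> : eps ^+ 2 * (1 - gamma) ^+ 2 / 36 * ((1 - gamma) ^+ 2 * K%:R)
    = eps ^+ 2 * (1 - gamma) ^+ 4 * K%:R / 36 by ring.
  lra.
have ea : expR (- (u ^+ 2 / (4 * v))) <= (delta / M) ^+ 2.
  have -> : (delta / M) ^+ 2 = expR (- (2 * a)).
    rewrite expRN -[2 * a]mulrC expRM_natr lnK ?posrE ?divr_gt0 //.
    by rewrite -exprVn invf_div.
  by rewrite ler_expR lerN2.
have JM : 2 * #|J|%:R <= 4 * M.
  rewrite /M !card_prod card_option card_ord !natrM -natr1.
  have : 0 <= #|S|%:R * #|A|%:R * (K%:R - 1) :> R.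
    by rewrite !mulr_ge0 // subr_ge0 ler1n.
  lra.
apply: (@le_trans _ _ (4 * M * (delta / M) ^+ 2)).
  by rewrite ler_pM ?mulr_ge0 ?expR_ge0.
have qM : delta / M * M = delta by rewrite divfK // gt_eqF.
rewrite (_ : 4 * M * _ = 4 * (delta / M * M) * (delta / M)); last by ring.
rewrite qM.
(* What remains is at most [4 * delta ^+ 2], below [3 * delta] as [delta < 1 / 3]. *)
have dM : delta / M <= delta by rewrite ler_pdivrMr // ler_peMr // ltW.
nra.
Qed.

Lemma accuracy :
  (1 - (1 - gamma) * lambda / 2) ^+ T * b
  + gamma * (w * gamma * H) / (1 - gamma) <= 2 / 3 * eps ->
  2304%:R * (lambda * ln (M / delta)) <= eps ^+ 2 * (1 - gamma) ^+ 4 * K%:R ->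
  ((1 - 3%:R * delta)%:E <= Pr [set om | (normQ (fun s a => Qs s a
    - avgQ a0 E gamma lambda r Q0 (fun t k s' a' => X t k s' a' om) T s a)
    <= eps)%R])%E.
Proof.
move=> hbias hnoise; have tail := error_tail hbias hnoise.
rewrite (_ : [set om | _] = [set om | error (samples T X om) <= eps]); last first.
  apply/seteqP; split=> om /=; rewrite /error (@avgQ_local _ _ _ _ _ _ _ _ _ _
    (draws (samples T X om)) (fun t k s' a' => X t k s' a' om)) // => t tT;
  by do 3 (apply/funext => ?); rewrite /draws insubT ffunE.
rewrite (samples_law (fun x => error x <= eps) Xlaw) lee_fin.
have := sum_weight p_sum1.
rewrite (bigID (fun x => error x <= eps)) /=.
under [X in _ + X]eq_bigl do rewrite -ltNge.
rewrite -/p; lra.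
Qed.

End Accuracy.

(** * Numerical constants *)

Section Numerics.
Variable R : realType.
Implicit Types g e k a b l x y : R.

(** [expR 1 <= 3] comes from [expR (- (1 / 6)) >= 5 / 6], since [(5 / 6) ^+ 6 >= 1 / 3]. *)
Lemma ln_ge1 y : 3 <= y -> 1 <= ln y.
Proof.
move=> y3; rewrite -[leLHS]expRK ler_ln ?posrE ?expR_gt0 //; last lra.
apply: le_trans y3.
have h : 5 / 6 <= expR (- (1 / 6) : R).
  by have := expR_ge1Dx (- (1 / 6) : R); lra.
have : (5 / 6) ^+ 6 <= expR (-1 : R).
  have -> : (-1 : R) = - (1 / 6) * 6%:R by field.
  by rewrite expRM_natr; apply: lerXn2r h; rewrite nnegrE ?expR_ge0 //; lra.
rewrite expRN => hi; rewrite -[leLHS]invrK -[3 in leRHS]invrK.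
by rewrite lef_pV2 ?posrE ?invr_gt0 ?expR_gt0 //; lra.
Qed.

(** [m] is 8 or 12, the denominators inside the logarithms of the thresholds. [bias_exponent] leaves
    [32 / 7 * (1 - gamma) * e / m], and [m >= 8]. *)
Lemma bias_le (T : nat) (gamma lambda e m : R) :
  0 < gamma < 1 -> 0 < lambda <= 1 -> 0 < e -> 8 <= m ->
  4 / 9 * ln ((1 - gamma) ^+ 2 * e / m) ^+ 2
    <= (1 - gamma) * lambda * T%:R / 2 ->
  (1 - (1 - gamma) * lambda / 2) ^+ T * (2 / (1 - gamma)) <= 4 / 7 * e.
Proof.
move=> /andP[g0 g1] /andP[l0 l1] e0 m8 hT.
have g1' : 0 < 1 - gamma by rewrite subr_gt0.
have y0 : 0 < (1 - gamma) ^+ 2 * e / m.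
  by rewrite divr_gt0 ?mulr_gt0 ?exprn_gt0 //; lra.
have gl : 0 <= (1 - gamma) * (1 - lambda) by rewrite mulr_ge0 ?subr_ge0 // ltW.
have rho_le : (1 - (1 - gamma) * lambda / 2) ^+ T
    <= expR (- ((1 - gamma) * lambda * T%:R / 2)).
  rewrite [X in expR X](_ : _ = - ((1 - gamma) * lambda / 2) * T%:R); last by ring.
  rewrite expRM_natr; apply: lerXn2r; rewrite ?nnegrE ?expR_ge0 //; first lra.
  exact: expR_ge1Dx.
have := le_trans rho_le (bias_exponent y0 hT) => h.
apply: le_trans (ler_wpM2r _ h) _; first by rewrite divr_ge0 ?ltW.
rewrite [leLHS](_ : _ = 32 / 7 * ((1 - gamma) * e) / m); last first.
  by field; rewrite !gt_eqF //; lra.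
rewrite ler_pdivrMr; last lra.
have : 0 <= e * (m - 8) by rewrite mulr_ge0 ?subr_ge0 // ltW.
have : 0 <= gamma * e by rewrite mulr_ge0 // ltW.
lra.
Qed.

(** [a] and [b] will be [ln (|S||A|K / delta)] and [ln T]. Being at least 1, they satisfy
    [(a + b) / 2 <= a * b], so the sum in the stepsize is beaten by the product in the bound on [T].
    For 2304 and 4096 the condition on [n] and [c] is an equality. *)
Lemma adaptive_exponent (T lambda g e k a b l c n : R) :
  0 < g -> 0 < e -> 0 < k -> 1 <= a -> 1 <= b -> 0 < n -> 16 * n <= 9 * c ->
  c * a * l ^+ 2 / (k * g ^+ 5 * e ^+ 2) * b <= T ->
  lambda = e ^+ 2 * g ^+ 4 * k / (n * (a + b)) ->
  4 / 9 * l ^+ 2 <= g * lambda * T / 2.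
Proof.
move=> g0 e0 k0 a1 b1 n0 nc hT ->.
have ab : 0 < a + b by lra.
have q0 : 0 < g * (e ^+ 2 * g ^+ 4 * k / (n * (a + b))) / 2.
  by rewrite !(divr_gt0, mulr_gt0, exprn_gt0).
have hq := ler_wpM2l (ltW q0) hT.
have qE : g * (e ^+ 2 * g ^+ 4 * k / (n * (a + b))) / 2
    * (c * a * l ^+ 2 / (k * g ^+ 5 * e ^+ 2) * b)
  = l ^+ 2 * (c * (a * b) / (2 * n * (a + b))).
  by field; rewrite !gt_eqF.
rewrite qE in hq.
have h : 4 / 9 <= c * (a * b) / (2 * n * (a + b)).
  rewrite ler_pdivlMr ?mulr_gt0 //.
  have ab1 : (a + b) / 2 <= a * b by nra.
  have : 16 / 9 * n * ((a + b) / 2) <= c * (a * b) by apply: ler_pM => //; nra.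
  lra.
have := ler_wpM2l (sqr_ge0 l) h; lra.
Qed.

Lemma ln_sqr_le l : l != 0 -> ln (l ^+ 2) <= 2 * `|l|.
Proof.
move=> l0; have l0' : 0 < `|l| by rewrite normr_gt0.
rewrite -real_normK ?num_real // lnXn // mulr2n.
by have := ln_sublinear l0'; lra.
Qed.

Lemma ln_accuracy_le (gamma e m Y : R) : 0 < gamma < 1 -> 0 < e ->
  1 <= m <= 12 -> 1 + `|ln (1 - gamma)| + `|ln e| <= Y ->
  `|ln ((1 - gamma) ^+ 2 * e / m)| <= 12 * Y.
Proof.
move=> /andP[g0 g1] e0 /andP[m1 m12] hY.
have g1' : 0 < 1 - gamma by rewrite subr_gt0.
have m0 : 0 < m by lra.
rewrite ln_div ?posrE ?mulr_gt0 ?exprn_gt0 // lnM ?posrE ?exprn_gt0 // lnXn //.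
have := ler_normB (ln (1 - gamma) *+ 2 + ln e) (ln m).
have := ler_normD (ln (1 - gamma) *+ 2) (ln e); rewrite normrMn mulr2n.
rewrite [`|ln m|]ger0_norm ?ln_ge0 //; have := ln_sublinear m0.
have := normr_ge0 (ln (1 - gamma)); have := normr_ge0 (ln e); lra.
Qed.

Lemma ln_expand x1 x2 x3 x4 x5 x6 : 0 < x1 -> 0 < x2 -> 0 < x3 -> 0 < x4 ->
  0 < x5 -> 0 < x6 ->
  ln (x1 * x2 * x3 / (x4 * x5 * x6)) =
  ln x1 + ln x2 + ln x3 - ln x4 - ln x5 - ln x6.
Proof.
move=> h1 h2 h3 h4 h5 h6.
by rewrite ln_div ?lnM ?posrE ?mulr_gt0 //; ring.
Qed.

(** All logarithms in [x] are at most multiples of [Y]: 144 is the square of the 12 in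
    [ln_accuracy_le], and [N + 32] collects the logarithms of the factors of [x]. *)
Lemma adaptive_complexity (nS nA K : nat) (gamma e delta c m Y N : R) :
  (0 < nS)%N -> (0 < nA)%N -> (0 < K)%N -> 0 < gamma < 1 -> 0 < e ->
  0 < delta < 3%:R^-1 -> 0 < c <= N -> 1 <= m <= 12 ->
  let a := ln ((nS * nA * K)%:R / delta) in
  let x := c * a * ln ((1 - gamma) ^+ 2 * e / m) ^+ 2
    / (K%:R * (1 - gamma) ^+ 5 * e ^+ 2) in
  expR 1 <= x ->
  Y = 1 + (`|ln nS%:R| + (`|ln nA%:R| + (`|ln K%:R| + (`|ln delta|
    + (`|ln (1 - gamma)| + `|ln e|))))) ->
  sample_complexity nS nA x <= 4 * (N * 144) * (N + 32) *
    ((nS * nA)%:R / (K%:R * (1 - gamma) ^+ 5 * e ^+ 2)) * Y ^+ 4.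
Proof.
move=> S0 A0 K0 g01 e0 /andP[d0 d1] /andP[c0 c1] m1 a x ex YE.
have /andP[g0 g1] := g01; have g1' : 0 < 1 - gamma by rewrite subr_gt0.
have K0' : 0 < K%:R :> R by rewrite ltr0n.
set l := ln (_ / m) in x ex *.
have x0 : 0 < x by apply: lt_le_trans ex; exact: expR_gt0.
have den0 : 0 < K%:R * (1 - gamma) ^+ 5 * e ^+ 2.
  by rewrite !(mulr_gt0, exprn_gt0).
have nY := (normr_ge0 (ln nS%:R : R), normr_ge0 (ln nA%:R : R),
  normr_ge0 (ln K%:R : R), normr_ge0 (ln delta), normr_ge0 (ln (1 - gamma)),
  normr_ge0 (ln e)).
move: nY => [[[[[n1 n2] n3] n4] n5] n6].
have Y1 : 1 <= Y by rewrite YE; lra.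
have l12 : `|l| <= 12 * Y by apply: ln_accuracy_le => //; rewrite YE; lra.
have aY : a <= Y.
  rewrite /a ln_div ?posrE ?ltr0n ?muln_gt0 ?S0 ?A0 // !natrM.
  rewrite !lnM ?posrE ?mulr_gt0 ?ltr0n //.
  have := ler_norm (ln nS%:R : R); have := ler_norm (ln nA%:R : R).
  have := ler_norm (ln K%:R : R); have := ler_norm (- ln delta).
  rewrite normrN YE; lra.
have a1 : 1 <= a.
  apply: ln_ge1; rewrite ler_pdivlMr //.
  have M1 : 1 <= (nS * nA * K)%:R :> R by rewrite ler1n !muln_gt0 S0 A0.
  lra.
have a0 : 0 < a by lra.
(* A zero logarithm would make [x] zero, against [expR 1 <= x]; [ln_sqr_le] relies on this. *)
have l0 : l != 0.
  by apply/eqP => lz; move: x0; rewrite /x lz expr0n /= mulr0 mul0r ltxx.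
have l2 : l ^+ 2 <= 144 * Y ^+ 2.
  rewrite -real_normK ?num_real // [leRHS](_ : _ = (12 * Y) ^+ 2); last by ring.
  by apply: lerXn2r => //; rewrite nnegrE //; lra.
have W : ln x <= (N + 32) * Y.
  have l20 : 0 < l ^+ 2 by rewrite exprn_even_gt0.
  rewrite /x (ln_expand c0 a0 l20 K0' (exprn_gt0 5 g1') (exprn_gt0 2 e0)).
  have := ln_sqr_le l0; have := ln_sublinear c0; have := ln_sublinear a0.
  rewrite (lnXn 5 g1') (lnXn 2 e0); have := ler_norm (- ln (1 - gamma)).
  have := ler_norm (- ln e); rewrite !normrN.
  have K1 : 0 <= ln K%:R :> R by rewrite ln_ge0 // ler1n.
  have NY : N <= N * Y by rewrite ler_peMr //; lra.
  lra.
apply: sample_complexity_le ex Y1 _ _ _ W; first lra.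
  by rewrite invr_ge0 ltW.
rewrite /x [leRHS]mulrAC ler_wpM2r ?invr_ge0 ?(ltW den0) //.
have : a * l ^+ 2 <= Y * (144 * Y ^+ 2).
  by apply: ler_pM => //; [exact: ltW | exact: sqr_ge0].
move=> h.
have : c * (a * l ^+ 2) <= N * (Y * (144 * Y ^+ 2)).
  apply: ler_pM => //; first exact: ltW.
  by rewrite mulr_ge0 ?sqr_ge0 // ltW.
lra.
Qed.

(** Since [kappa <= 2], [ln (168 * kappa)] is below 336 and goes into [N]; hence [kappa] is not
    among the hidden logarithms. *)
Lemma drift_complexity (nS nA E : nat) (gamma e kappa Y N : R) :
  (1 < E)%N -> 0 < gamma < 1 -> 0 < e -> 0 < kappa <= 2 -> 336 <= N ->
  let x := x2 E kappa gamma e in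
  expR 1 <= x ->
  Y = 1 + (`|ln E%:R| + (`|ln (1 - gamma)| + `|ln e|)) ->
  sample_complexity nS nA x <= 4 * (N * 144) * (N + 32) *
    (kappa * (nS * nA)%:R * E%:R / ((1 - gamma) ^+ 3 * e)) * Y ^+ 4.
Proof.
move=> E1 g01 e0 /andP[k0 k2] N336 x ex YE.
have /andP[g0 g1] := g01; have g1' : 0 < 1 - gamma by rewrite subr_gt0.
have E1' : 1 < E%:R :> R by rewrite ltr1n.
have x0 : 0 < x by apply: lt_le_trans ex; exact: expR_gt0.
pose l := ln ((1 - gamma) ^+ 2 * e / 12).
have xE : x = 168 * kappa * (E%:R - 1) * gamma ^+ 2 / ((1 - gamma) ^+ 3 * e)
  * l ^+ 2 by [].
have den0 : 0 < (1 - gamma) ^+ 3 * e by rewrite !(mulr_gt0, exprn_gt0).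
have := (normr_ge0 (ln E%:R : R), normr_ge0 (ln (1 - gamma)), normr_ge0 (ln e)).
move=> [[n1 n5] n6].
have Y1 : 1 <= Y by rewrite YE; lra.
have l12 : `|l| <= 12 * Y by apply: ln_accuracy_le => //; rewrite ?YE; lra.
have l0 : l != 0.
  by apply/eqP => lz; move: x0; rewrite xE lz expr0n /= mulr0 ltxx.
have l2 : l ^+ 2 <= 144 * Y ^+ 2.
  rewrite -real_normK ?num_real // [leRHS](_ : _ = (12 * Y) ^+ 2); last by ring.
  by apply: lerXn2r => //; rewrite nnegrE //; lra.
have l20 : 0 < l ^+ 2 by rewrite exprn_even_gt0.
have gE : (E%:R - 1) * gamma ^+ 2 <= E%:R.
  rewrite -[leRHS]mulr1; apply: ler_pM; rewrite ?sqr_ge0 //; try lra.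
  by rewrite expr_le1 // ltW.
have xle : x <= 168 * kappa * E%:R / ((1 - gamma) ^+ 3 * e) * l ^+ 2.
  rewrite xE ler_pM2r // ler_pM2r ?invr_gt0 // -!mulrA.
  by rewrite ler_pM2l // ler_pM2l.
have W : ln x <= (N + 32) * Y.
  apply: (@le_trans _ _ (ln (168 * kappa * E%:R / ((1 - gamma) ^+ 3 * e) * l ^+ 2))).
    by rewrite ler_ln // posrE; exact: lt_le_trans xle.
  have -> : 168 * kappa * E%:R / ((1 - gamma) ^+ 3 * e) * l ^+ 2
     = (168 * kappa) * E%:R * l ^+ 2 / (1 * (1 - gamma) ^+ 3 * e).
    by rewrite mul1r mulrAC.
  have E0' : 0 < E%:R :> R by lra.
  have k0' : 0 < 168 * kappa by lra.
  rewrite (ln_expand k0' E0' l20 ltr01 (exprn_gt0 3 g1') e0) ln1 (lnXn 3 g1').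
  have := ln_sqr_le l0.
  have := ln_sublinear k0'.
  have := ler_norm (- ln (1 - gamma)); have := ler_norm (ln E%:R : R).
  have := ler_norm (- ln e); rewrite !normrN.
  have NY : N <= N * Y by rewrite ler_peMr //; lra.
  lra.
have -> : kappa * (nS * nA)%:R * E%:R / ((1 - gamma) ^+ 3 * e)
  = (nS * nA)%:R * (kappa * E%:R / ((1 - gamma) ^+ 3 * e)) by ring.
have g0' : 0 <= kappa * E%:R / ((1 - gamma) ^+ 3 * e).
  by rewrite divr_ge0 ?mulr_ge0 ?(ltW k0) // ltW.
apply: (sample_complexity_le _ _ ex Y1 _ g0' _ W); first lra.
apply: le_trans xle _.
have : l ^+ 2 <= 144 * Y ^+ 3.
  apply: le_trans l2 _; rewrite ler_pM2l // exprS ler_peMl ?sqr_ge0 //.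
move=> h; have := ler_wpM2l g0' h.
have gY := mulr_ge0 g0' (exprn_ge0 3 (le_trans ler01 Y1)).
have := ler_wpM2r gY N336; lra.
Qed.

End Numerics.

Lemma heterogeneity_ge0 (R : realType) (S A : finType) (K : nat)
    (Pk : 'I_K -> S -> A -> S -> R) : 0 <= heterogeneity Pk.
Proof. exact: bigmax_ge_id. Qed.

Lemma heterogeneity_le2 (R : realType) (S A : finType) (K : nat)
    (Pk : 'I_K -> S -> A -> S -> R) : (0 < K)%N ->
  (forall k, transition_kernel (Pk k)) -> heterogeneity Pk <= 2.
Proof.
move=> K0 Pker; have [G0 G1] := global_kernel_kernel K0 Pker.
apply: bigmax_le => // -[[k s] a] _ /=; have [p0 p1] := Pker k.
apply: (@le_trans _ _ (\sum_s' (global_kernel Pk s a s' + Pk k s a s'))).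
  by apply: ler_sum => s' _; apply: le_trans (ler_normB _ _) _; rewrite !ger0_norm.
by rewrite big_split /= G1 p1; lra.
Qed.

(** * Assembly of the three regimes *)

Unset Implicit Arguments.

Theorem corollary2 (R : realType) :
  exists (C : R) (p : nat),
  forall (S A : finType) (a0 : A) (K E T : nat) (gamma lambda eps : R)
    (r : S -> A -> R) (Pk : 'I_K -> S -> A -> S -> R)
    (Q0 Qstar : S -> A -> R)
    (d : measure_display) (Omega : measurableType d)
    (Pr : probability Omega R) (X : nat -> 'I_K -> S -> A -> Omega -> S),
  (0 < #|S|)%N -> (0 < K)%N -> (0 < E)%N -> (0 < T)%N ->
  0 < gamma < 1 -> 0 < lambda -> 0 < eps ->
  (forall s a, 0 <= r s a <= 1) ->
  (forall k, transition_kernel (Pk k)) ->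
  (forall s a, 0 <= Q0 s a <= (1 - gamma)^-1) ->
  optimal_Q a0 (global_kernel Pk) gamma r Qstar ->
  generative_samples Pr T Pk X ->
  E%:R - 1 <= lambda^-1 * Num.min ((1 - gamma) / (4%:R * gamma)) K%:R^-1 ->
  lambda <= E%:R^-1 ->
  let kappa := heterogeneity Pk in
  let nSA : R := (#|S| * #|A|)%:R in
  let Delta (w : Omega) (s : S) (a : A) : R :=
    Qstar s a
    - avgQ a0 E gamma lambda r Q0 (fun t k s' a' => X t k s' a' w) T s a in
  let accurate (delta : R) : Prop :=
    ((1 - 3%:R * delta)%:E <= Pr [set w | (normQ (Delta w) <= eps)%R])%E in
  let lambda_T (delta : R) : R :=
    eps ^+ 2 * (1 - gamma) ^+ 4 * K%:R
    / (2304%:R * ln ((#|S| * #|A| * K * T)%:R / delta)) in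
  let KE_bound (delta : R) : R :=
    55%:R * ln ((#|S| * #|A| * K)%:R / delta)
    / (kappa * gamma ^+ 2 * eps * (1 - gamma) ^+ 2) in
  [/\ kappa = 0 \/ E = 1%N ->
      forall delta : R, 0 < delta < 3%:R^-1 ->
      let x := x1 #|S| #|A| K gamma eps delta in
      expR 1 <= x ->
      (threshold x <= T%:R -> lambda = lambda_T delta -> accurate delta) /\
      sample_complexity #|S| #|A| x
        <= C * (nSA / (K%:R * (1 - gamma) ^+ 5 * eps ^+ 2))
           * polylog p [:: #|S|%:R; #|A|%:R; K%:R; delta; 1 - gamma; eps],
      0 < kappa -> (1 < E)%N ->
      forall delta : R, 0 < delta < 3%:R^-1 ->
      K%:R * (E%:R - 1) >= KE_bound delta ->
      let x := x2 E kappa gamma eps in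
      expR 1 <= x ->
      (threshold x <= T%:R ->
       lambda = eps * (1 - gamma) ^+ 2
                / (42%:R * kappa * (E%:R - 1) * gamma ^+ 2) ->
       accurate delta) /\
      sample_complexity #|S| #|A| x
        <= C * (kappa * nSA * E%:R / ((1 - gamma) ^+ 3 * eps))
           * polylog p [:: E%:R; 1 - gamma; eps]
    & 0 < kappa -> (1 < E)%N ->
      forall delta : R, 0 < delta < 3%:R^-1 ->
      K%:R * (E%:R - 1) <= KE_bound delta ->
      let x := x3 #|S| #|A| K gamma eps delta in
      expR 1 <= x ->
      (threshold x <= T%:R -> lambda = lambda_T delta -> accurate delta) /\
      sample_complexity #|S| #|A| x
        <= C * (nSA / (K%:R * (1 - gamma) ^+ 5 * eps ^+ 2))
           * polylog p [:: #|S|%:R; #|A|%:R; K%:R; delta; 1 - gamma; eps]].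
Proof.
(* One [N] dominates all leading constants: 4096, 9216, and [336 = 168 * 2] from [kappa <= 2]. *)
have [N hN] : exists N : R, [/\ 336 <= N, 4096%:R <= N & N = 9216%:R].
  by exists 9216%:R; rewrite !ler_nat.
exists (4 * (N * 144) * (N + 32)), 4%N.
move=> S A a0 K E T gamma lambda eps r Pk Q0 Qs d Omega Pr X.
move=> S0 K0 E0 T0 g01 l0 e0 r01 Pker Q0b Qopt Xlaw lE lE1.
move=> kappa nSA Delta accurate lambda_T KE_bound.
have /andP[g0 g1] := g01; have g1' : 0 < 1 - gamma by rewrite subr_gt0.
have A0 : (0 < #|A|)%N by apply/card_gt0P; exists a0.
have K0' : 0 < K%:R :> R by rewrite ltr0n.
have E1' : 1 <= E%:R :> R by rewrite ler1n.
have k0 : 0 <= kappa by exact: heterogeneity_ge0.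
have l01 : 0 < lambda <= 1.
  by rewrite l0 (le_trans lE1) // invf_le1 ?ltr0n.
pose a delta := ln ((#|S| * #|A| * K)%:R / delta : R).
have a1 delta : 0 < delta < 3%:R^-1 -> 1 <= a delta.
  move=> /andP[d0 d1]; apply: ln_ge1; rewrite ler_pdivlMr //.
  have : 1 <= (#|S| * #|A| * K)%:R :> R by rewrite ler1n !muln_gt0 S0 A0.
  lra.
pose drift_term := gamma * (lambda * (E%:R - 1) * gamma
  * (kappa * (1 - gamma)^-1)) / (1 - gamma).
have drift_termE : drift_term =
    lambda * (E%:R - 1) * kappa * gamma ^+ 2 / (1 - gamma) ^+ 2.
  by rewrite /drift_term; field; rewrite gt_eqF.
(* Bias budget: [4 / 7 + 1 / 40 <= 2 / 3]. The share [eps / 40] covers both [eps / 42] in case (a)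
   and [55 / 2304 * eps] in case (b). *)
have acc delta m : 0 < delta < 3%:R^-1 -> 8 <= m ->
    4 / 9 * ln ((1 - gamma) ^+ 2 * eps / m) ^+ 2
      <= (1 - gamma) * lambda * T%:R / 2 ->
    drift_term <= eps / 40 ->
    2304%:R * (lambda * a delta) <= eps ^+ 2 * (1 - gamma) ^+ 4 * K%:R ->
    accurate delta.
  move=> d01 m8 hT hd hn.
  have := bias_le g01 l01 e0 m8 hT => hb.
  by apply: (accuracy S0 K0 E0 g01 l0 e0 r01 Pker Q0b Qopt lE lE1 d01 Xlaw) => //;
    rewrite -/drift_term; lra.
(* Common to (i) and (b), which differ in [c], [m] and the reason why the heterogeneity bias is
   small. *)
have adaptive delta c m : 0 < delta < 3%:R^-1 -> 4096%:R <= c -> 8 <= m ->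
    let x := c * a delta * ln ((1 - gamma) ^+ 2 * eps / m) ^+ 2
      / (K%:R * (1 - gamma) ^+ 5 * eps ^+ 2) in
    expR 1 <= x -> threshold x <= T%:R -> lambda = lambda_T delta ->
    (lambda = eps ^+ 2 * (1 - gamma) ^+ 4 * K%:R
       / (2304%:R * (a delta + ln T%:R)) -> 1 <= ln T%:R :> R ->
     drift_term <= eps / 40) -> accurate delta.
  move=> d01 c4 m8 x ex xT lT hd; have /andP[d0 d1] := d01.
  have [xlnT lnT] := threshold_le_mono ex xT.
  have {}lT : lambda = eps ^+ 2 * (1 - gamma) ^+ 4 * K%:R
       / (2304%:R * (a delta + ln T%:R)).
    rewrite lT /lambda_T; congr (_ / (_ * _)).
    by rewrite natrM mulrAC lnM ?posrE ?divr_gt0 ?ltr0n // !muln_gt0 S0 A0.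
  have n0 : 0 < 2304%:R :> R by rewrite ltr0n.
  have a1d := a1 _ d01.
  apply: (acc delta m) => //; last first.
  (* The left side is the right side times [a / (a + ln T) <= 1]. *)
  - rewrite {}lT; have : 0 < a delta + ln T%:R.
      by rewrite addr_gt0 // (lt_le_trans ltr01).
    have : a delta <= a delta + ln T%:R by rewrite lerDl (le_trans ler01).
    have : 0 <= eps ^+ 2 * (1 - gamma) ^+ 4 * K%:R.
      by rewrite !mulr_ge0 ?exprn_ge0 // ltW.
    move: (eps ^+ 2 * _ * _) (a delta) (a delta + _) n0 => u v w n0 u0 vw w0.
    move: 2304%:R n0 => n n0.
    have -> : n * (u / (n * w) * v) = u * (v / w).
      by field; rewrite !gt_eqF.
    by rewrite ler_piMr // ler_pdivrMr // mul1r.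
  - exact: hd.
  apply: (adaptive_exponent g1' e0 K0' a1d lnT n0 _ xlnT lT).
  by clear -c4; lra.
have YE (c1 c2 c3 c4 c5 c6 : R) : 1 + \sum_(c <- [:: c1; c2; c3; c4; c5; c6]) `|ln c| =
   1 + (`|ln c1| + (`|ln c2| + (`|ln c3| + (`|ln c4| + (`|ln c5| + `|ln c6|))))).
  by rewrite !big_cons big_nil addr0.
split.
- move=> kE delta d01 x ex; split.
    move=> xT lT; apply: (adaptive delta 4096%:R 8%:R) => //; rewrite ?lexx //.
    move=> _ _; rewrite drift_termE (_ : lambda * _ * _ = 0) ?mul0r; last first.
      by case: kE => ->; rewrite ?subrr ?mulr0 ?mul0r.
    by rewrite divr_ge0 // ltW.
  apply: (adaptive_complexity S0 A0 K0 g01 e0 d01 _ _ ex (YE _ _ _ _ _ _)).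
    by have [_ N4 _] := hN; rewrite N4 andbT ltr0n.
  by rewrite ler1n ler_nat.
- move=> kp E1 delta d01 hKE x ex; split.
    move=> xT lT; have [xlnT lnT] := threshold_le_mono ex xT.
    have D0 : 0 < kappa * (E%:R - 1) * gamma ^+ 2.
      by rewrite !mulr_gt0 ?exprn_gt0 // subr_gt0 ltr1n.
    have [Em kne] : E%:R - 1 != 0 :> R /\ kappa != 0.
      by rewrite !gt_eqF // subr_gt0 ltr1n.
    apply: (acc delta 12%:R) => //; first by rewrite ler_nat.
    + set l := ln _.
      have gl0 : 0 < (1 - gamma) * lambda by rewrite mulr_gt0.
      have := ler_wpM2l (ltW gl0) xlnT.
      (* The 168 in [x2] against the 42 in the stepsize leaves 4; half of [4 * l ^+ 2] exceeds the
         required [4 / 9 * l ^+ 2]. *)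
      rewrite mulrA (_ : _ * x = 4 * l ^+ 2); last first.
        by rewrite /x /x2 -/l lT; field; rewrite ?Em ?kne ?gt_eqF.
      have := ler_wpM2l (sqr_ge0 l) lnT; have := sqr_ge0 l.
      by clear; lra.
    + rewrite drift_termE lT (_ : _ / _ = eps / 42); first by clear -e0; lra.
      by field; rewrite ?Em ?kne ?gt_eqF.
    + move: hKE; rewrite /KE_bound -/(a delta) ler_pdivrMr; last first.
        by rewrite !mulr_gt0 ?exprn_gt0.
      move=> hKE; rewrite lT.
      (* [2304 / 42] is just below 55, the constant in [KE_bound]. *)
      rewrite (_ : 2304%:R * _ = 2304%:R / 42%:R * (eps * (1 - gamma) ^+ 2
        * a delta) / (kappa * (E%:R - 1) * gamma ^+ 2)); last first.
        by field; rewrite ?Em ?kne ?gt_eqF.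
      rewrite ler_pdivrMr //.
      have eg : 0 <= eps * (1 - gamma) ^+ 2 by rewrite mulr_ge0 ?exprn_ge0 // ltW.
      have := ler_wpM2l eg hKE.
      have := mulr_ge0 eg (le_trans ler01 (a1 _ d01)).
      by clear; lra.
  apply: drift_complexity => //.
  + rewrite kp; exact: heterogeneity_le2.
  + by have [] := hN.
  + by rewrite !big_cons big_nil addr0.
- move=> kp E1 delta d01 hKE x ex.
  have xE : x = N * a delta * ln ((1 - gamma) ^+ 2 * eps / 12%:R) ^+ 2
      / (K%:R * (1 - gamma) ^+ 5 * eps ^+ 2).
    have [_ _ NE] := hN.
    by rewrite /x /x3 -NE -/(a delta) [RHS]mulrAC [N / _ * _]mulrAC.
  rewrite xE in ex *; split.
    move=> xT lT; apply: (adaptive delta N 12%:R) => //; first by have [] := hN.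
      by rewrite ler_nat.
    move=> {}lT lnT; rewrite drift_termE lT.
    have a1d := a1 _ d01.
    have ab0 : 0 < a delta + ln T%:R by rewrite addr_gt0 // (lt_le_trans ltr01).
    move: hKE; rewrite /KE_bound -/(a delta) ler_pdivlMr; last first.
      by rewrite !mulr_gt0 ?exprn_gt0.
    move=> hKE.
    (* The reversed [KE_bound] inequality caps the quotient at 55, and [55 / 2304 <= 1 / 40]. *)
    rewrite (_ : _ / _ = eps / 2304%:R * ((K%:R * (E%:R - 1)
      * (kappa * gamma ^+ 2 * eps * (1 - gamma) ^+ 2)) / (a delta + ln T%:R))).
      have q : K%:R * (E%:R - 1) * (kappa * gamma ^+ 2 * eps * (1 - gamma) ^+ 2)
        / (a delta + ln T%:R) <= 55%:R.
        by rewrite ler_pdivrMr //; apply: le_trans hKE _; rewrite ler_pM2l // lerDl (le_trans ler01).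
      by have := ler_wpM2l (ltW e0) q; clear -e0; lra.
    by field; rewrite !gt_eqF.
  apply: (adaptive_complexity S0 A0 K0 g01 e0 d01 _ _ ex (YE _ _ _ _ _ _)).
    by case: hN => N3 _ _; rewrite lexx andbT (lt_le_trans _ N3) ?ltr0n.
  by rewrite ler1n lexx.
Qed.
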